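(* Let $A$ be an algebra and let $\mathcal C$ be an $A$-coring that is flat as a left $A$-module. Then: (1) Every Galois right $\mathcal C$-comodule whose endomorphism ring $\mathrm{End}^{-\mathcal C}(M)$ is a division ring is a simple comodule (i.e. a simple object in $\mathbf M^{\mathcal C}$). (2) Let $M$ be a simple right $\mathcal C$-comodule that is finitely generated and projective as a right $A$-module, and let $S=\mathrm{End}^{-\mathcal C}(M)$. Then the following are equivalent: (a) $M$ is a Galois comodule. (b) For all $N\in\mathbf M^{\mathcal C}$, the evaluation map $\varphi_N:\mathrm{Hom}^{-\mathcal C}(M,N)\otimes_S M\to N$, $f\otimes m\mapsto f(m)$, is surjective. (c) The evaluation map $\varphi_{\mathcal C}:\mathrm{Hom}^{-\mathcal C}(M,\mathcal C)\otimes_S M\to\mathcal C$, $f\otimes m\mapsto f(m)$, is surjective. (d) The canonical map $\mathrm{can}_M:M^*\otimes_S M\to\mathcal C$, $\xi\otimes m\mapsto\sum\xi(m_{(0)})m_{(1)}$, is a surjective morphism of $A$-corings.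
   Context: Algebras are associative unital algebras over a commutative unital ring $k$. An $A$-coring $\mathcal C$ is an $(A,A)$-bimodule with coassociative coproduct $\Delta_{\mathcal C}:\mathcal C\to\mathcal C\otimes_A\mathcal C$ and counit $\varepsilon_{\mathcal C}:\mathcal C\to A$ (both bimodule maps). $\mathbf M^{\mathcal C}$ is the category of right $\mathcal C$-comodules (right $A$-modules $M$ with a right $A$-linear coassociative counital coaction $\varrho^M:M\to M\otimes_A\mathcal C$, $\varrho^M(m)=\sum m_{(0)}\otimes m_{(1)}$) and colinear maps; $\mathrm{Hom}^{-\mathcal C}(M,N)$ denotes the $k$-module of right $\mathcal C$-colinear maps and $\mathrm{End}^{-\mathcal C}(M)$ the endomorphism ring with product given by composition. Thus $M$ is a left module and $\mathrm{Hom}^{-\mathcal C}(M,N)$ (via $fs=f\circ s$) a right module over $S=\mathrm{End}^{-\mathcal C}(M)$. $\mathcal C$ is a right $\mathcal C$-comodule via $\Delta_{\mathcal C}$. $M^*=\mathrm{Hom}_{-A}(M,A)$ is an $(A,S)$-bimodule, with $\xi s=\xi\circ s$. A right $\mathcal C$-comodule $M$ is a Galois comodule if it is finitely generated and projective as a right $A$-module and $\varphi_{\mathcal C}:\mathrm{Hom}^{-\mathcal C}(M,\mathcal C)\otimes_S M\to\mathcal C$, $f\otimes m\mapsto f(m)$, is an isomorphism of right $\mathcal C$-comodules. If $M_A$ is finitely generated projective with dual basis $\{e^i\in M,\xi^i\in M^*\}$, then $M^*\otimes_S M$ is an $A$-coring with coproduct $\xi\otimes m\mapsto\sum_i\xi\otimes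 e^i\otimes\xi^i\otimes m$ and counit $\xi\otimes m\mapsto\xi(m)$, and $\mathrm{can}_M$ is a morphism of $A$-corings. A simple object is a nonzero object $M$ such that every monomorphism $N\to M$ is either $0$ or an isomorphism. *)

(* Defs.v *)
From HB Require Import structures.
From mathcomp Require Import all_boot ssralg ssrint.
From mathcomp Require Import ring_quotient generic_quotient.
From mathcomp Require Import freeg.
From mathcomp Require Import boolp.

Set Implicit Arguments.
Unset Strict Implicit.
Unset Printing Implicit Defensive.

Import GRing.Theory.
Local Open Scope ring_scope.

Reserved Notation "m :* a" (at level 40).
Reserved Notation "m ⊗ n" (at level 40, left associativity).

(* Right modules are not encoded as left modules over R^c: the carrier of a
   bimodule would then carry two left module structures over rings with the
   same underlying type. *)
HB.mixin Record Zmodule_isRmodule (R : pzRingType) M of GRing.Zmodule M := {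
  ract : M -> R -> M;
  ractA : forall m a b, ract (ract m a) b = ract m (a * b);
  ract1 : forall m, ract m 1 = m;
  ractDl : forall a, {morph ract^~ a : m m' / m + m'};
  ractDr : forall m, {morph ract m : a b / a + b} }.

#[short(type="rmodType")]
HB.structure Definition Rmodule (R : pzRingType) :=
  {M of GRing.Zmodule M & Zmodule_isRmodule R M}.

Notation "m :* a" := (ract m a) : ring_scope.

HB.mixin Record LRmodule_isBimodule (B R : pzRingType) M
    of GRing.Lmodule B M & Rmodule R M := {
  scale_ract : forall (b : B) (m : M) (r : R), b *: (m :* r) = (b *: m) :* r }.

#[short(type="bimodType")]
HB.structure Definition Bimodule (B R : pzRingType) :=
  {M of GRing.Lmodule B M & Rmodule R M & LRmodule_isBimodule B R M}.

Definition rlinear (R : pzRingType) (M N : rmodType R) (f : M -> N) :=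
  {morph f : x y / x + y} /\ forall m a, f (m :* a) = f m :* a.

Section Tensor.
Variables (R : pzRingType) (M : rmodType R) (N : lmodType R).

Local Notation F := {freeg (M * N)%type / int}.

Inductive tensor_rel : F -> Prop :=
  | tensor_relDl m m' n : tensor_rel (<< (m + m', n) >> - << (m, n) >> - << (m', n) >>)
  | tensor_relDr m n n' : tensor_rel (<< (m, n + n') >> - << (m, n) >> - << (m, n') >>)
  | tensor_relA m a n : tensor_rel (<< (m :* a, n) >> - << (m, a *: n) >>)
  | tensor_rel0 : tensor_rel 0
  | tensor_relB x y : tensor_rel x -> tensor_rel y -> tensor_rel (x - y).

Definition tensor_ker : {pred F} := fun x => `[< tensor_rel x >].

Lemma tensor_ker_closed : zmod_closed tensor_ker.
Proof.
split=> [|x y /asboolP kx /asboolP ky]; apply/asboolP.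
  exact: tensor_rel0.
exact: tensor_relB.
Qed.
HB.instance Definition _ := GRing.isZmodClosed.Build F tensor_ker tensor_ker_closed.

(* M ⊗_R N: the free abelian group on M * N modulo the balancing relations *)
Definition tensor : Type := Quotient.quot tensor_ker.
HB.instance Definition _ := GRing.Zmodule.on tensor.

Definition tens (m : M) (n : N) : tensor := \pi_(Quotient.quot tensor_ker)%qT << (m, n) >>.

Definition balanced (G : zmodType) (f : M -> N -> G) :=
  [/\ forall n, {morph f^~ n : m m' / m + m'},
      forall m, {morph f m : n n' / n + n'} &
      forall m a n, f (m :* a) n = f m (a *: n)].

(* The additive map induced by a balanced map f; its value is irrelevant when
   f is not balanced. *)
Definition tlift (G : zmodType) (f : M -> N -> G) (t : tensor) : G :=
  fglift (fun p => f p.1 p.2 : zmodule G) (repr t : F).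

Local Notation Q := (Quotient.quot tensor_ker).

Lemma tensor_rel_pi x y : tensor_rel (x - y) -> \pi_Q%qT x = \pi_Q%qT y.
Proof. by move=> xy; apply/eqP; rewrite -Quotient.idealrBE; apply/asboolP. Qed.

Lemma piB (x y : F) : \pi_Q%qT (x - y) = \pi_Q%qT x - \pi_Q%qT y :> Q.
Proof. exact: raddfB. Qed.

Lemma tens_balanced : balanced tens.
Proof.
have addP (x y z : F) : tensor_rel (x - y - z) ->
    \pi_Q%qT x = \pi_Q%qT y + \pi_Q%qT z :> Q.
  move=> xyz; rewrite -[z]opprK -[- - z]add0r.
  rewrite [X in _ + X]piB raddf0 sub0r -piB; apply: tensor_rel_pi.
  by rewrite opprD opprK addrA.
split=> [n m m'|m n n'|m a n].
- by apply: addP; apply: tensor_relDl.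
- by apply: addP; apply: tensor_relDr.
- by apply: tensor_rel_pi; apply: tensor_relA.
Qed.

Lemma tensDl n : {morph tens^~ n : m m' / m + m'}.
Proof. by case: tens_balanced. Qed.

Lemma tensDr m : {morph tens m : n n' / n + n'}.
Proof. by case: tens_balanced. Qed.

Lemma tensA m a n : tens (m :* a) n = tens m (a *: n).
Proof. by case: tens_balanced. Qed.

Lemma tens0l n : tens 0 n = 0.
Proof. by apply: (addIr (tens 0 n)); rewrite -tensDl !add0r. Qed.

Lemma tens0r m : tens m 0 = 0.
Proof. by apply: (addIr (tens m 0)); rewrite -tensDr !add0r. Qed.

Lemma tensNl m n : tens (- m) n = - tens m n.
Proof. by apply: (addIr (tens m n)); rewrite -tensDl !addNr tens0l. Qed.

Lemma tens_suml n (I : Type) (r : seq I) (P : pred I) (f : I -> M) :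
  tens (\sum_(i <- r | P i) f i) n = \sum_(i <- r | P i) tens (f i) n.
Proof. exact: (big_morph _ (tensDl n) (tens0l n)). Qed.

Lemma tens_sumr m (I : Type) (r : seq I) (P : pred I) (f : I -> N) :
  tens m (\sum_(i <- r | P i) f i) = \sum_(i <- r | P i) tens m (f i).
Proof. exact: (big_morph _ (tensDr m) (tens0r m)). Qed.

Lemma tensor_ind (P : tensor -> Prop) :
  (forall m n, P (tens m n)) -> (forall s t, P s -> P t -> P (s + t)) ->
  forall t, P t.
Proof.
move=> Pt PD; have P0 : P 0 by rewrite -(tens0l 0); apply: Pt.
have piD (x y : F) : \pi_Q%qT (x + y) = \pi_Q%qT x + \pi_Q%qT y :> Q.
  exact: raddfD.
have Pc c m n : P (\pi_Q%qT << c *g (m, n) >>).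
  have -> : << c *g (m, n) >> = << (m, n) >> *~ c :> F.
    by rewrite freegU_mulz intz.
  have -> : \pi_Q%qT (<< (m, n) >> *~ c : F) = tens m n *~ c.
    exact: (raddfMz (\pi_Q%qT : {additive F -> Q})).
  elim/int_rec: c => [|i IH|i IH]; first by rewrite mulr0z.
    by rewrite intS mulrzDr mulr1z; apply: PD IH.
  rewrite intS opprD mulrzDr; apply: PD IH.
  by rewrite mulrNz mulr1z -tensNl; apply: Pt.
have Ppi (x : F) : P (\pi_Q%qT x).
  rewrite -(freeg_sumE x); move: (dom x) => r.
  elim: r => [|[m n] r IH]; first by rewrite big_nil (raddf0 (\pi_Q%qT : {additive F -> Q})).
  by rewrite big_cons piD; apply: PD IH.
by move=> t; rewrite -[t](@reprK _ Q); apply: Ppi.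
Qed.

Lemma tensor_ext (G : zmodType) (f g : tensor -> G) :
  {morph f : x y / x + y} -> {morph g : x y / x + y} ->
  (forall m n, f (tens m n) = g (tens m n)) -> f =1 g.
Proof.
by move=> fD gD fg; apply: tensor_ind => // s t fs ft; rewrite fD gD fs ft.
Qed.

Section Lift.
Variables (G : zmodType) (f : M -> N -> G).
Hypothesis bal_f : balanced f.

Let L (x : F) : G := fglift (fun p => f p.1 p.2 : zmodule G) x.

Let LB x y : L (x - y) = L x - L y.
Proof. exact: (@lift_is_additive _ _ (zmodule G) (fun p => f p.1 p.2) x y). Qed.

Let LU m n : L << (m, n) >> = f m n.
Proof. by rewrite /L liftU. Qed.

Let L_ker x : tensor_rel x -> L x = 0.
Proof.
have [fDl fDr fA] := bal_f.
elim=> {x} [m m' n|m n n'|m a n||x y _ Lx _ Ly]; rewrite ?LB ?LU.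
- by rewrite fDl addrAC addrK subrr.
- by rewrite fDr addrAC addrK subrr.
- by rewrite fA subrr.
- by have := LB 0 0; rewrite !subrr.
- by rewrite Lx Ly subrr.
Qed.

Let L_pi x : tlift f (\pi_Q%qT x) = L x.
Proof.
apply/eqP; rewrite -subr_eq0 -LB L_ker //.
apply/asboolP; change (repr (\pi_Q%qT x) - x \in tensor_ker).
by rewrite Quotient.idealrBE reprK.
Qed.

Lemma tliftE m n : tlift f (tens m n) = f m n.
Proof. by rewrite L_pi LU. Qed.

Lemma tliftD : {morph tlift f : x y / x + y}.
Proof.
have L0 : L 0 = 0 by have := LB 0 0; rewrite !subrr.
have LN y : L (- y) = - L y by rewrite -(sub0r y) LB L0 sub0r.
move=> x y; rewrite -[x](@reprK _ Q) -[y](@reprK _ Q).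
have -> : \pi_Q%qT (repr x) + \pi_Q%qT (repr y) = \pi_Q%qT (repr x + repr y) :> Q.
  by rewrite raddfD.
rewrite !L_pi; move: (repr x) (repr y) => /= u v.
by rewrite -{1}[v]opprK LB LN opprK.
Qed.

End Lift.
End Tensor.
Notation "m ⊗ n" := (tens m n) : ring_scope.
#[global] Opaque tensor tens tlift.

Section TensorMap.
Variables (R : pzRingType).

Definition tmap (M M' : rmodType R) (N N' : lmodType R)
    (f : M -> M') (g : N -> N') : tensor M N -> tensor M' N' :=
  tlift (fun m n => f m ⊗ g n).

Variables (M M' : rmodType R) (N N' : lmodType R).

Lemma tmap_balanced (f : M -> M') (g : N -> N') :
  rlinear f -> linear g -> balanced (fun m n => f m ⊗ g n).
Proof.
move=> [fD fA] g_lin.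
have gD : {morph g : x y / x + y}.
  by move=> x y; have := g_lin 1 x y; rewrite !scale1r.
have g0 : g 0 = 0 by apply: (addIr (g 0)); rewrite -gD !add0r.
have gZ a x : g (a *: x) = a *: g x.
  by have := g_lin a x 0; rewrite !addr0 g0 addr0.
split=> [n m m'|m n n'|m a n].
- by rewrite fD tensDl.
- by rewrite gD tensDr.
- by rewrite fA gZ tensA.
Qed.

Lemma tmapE (f : M -> M') (g : N -> N') : rlinear f -> linear g ->
  forall m n, tmap f g (m ⊗ n) = f m ⊗ g n.
Proof. by move=> fl gl m n; rewrite /tmap tliftE //; apply: tmap_balanced. Qed.

Lemma tmapD (f : M -> M') (g : N -> N') : rlinear f -> linear g ->
  {morph tmap f g : x y / x + y}.
Proof. by move=> fl gl; apply/tliftD/tmap_balanced. Qed.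

End TensorMap.

Lemma rlinear_id (R : pzRingType) (M : rmodType R) : rlinear (@idfun M).
Proof. by []. Qed.

Lemma linear_id (R : pzRingType) (M : lmodType R) : linear (@idfun M).
Proof. by []. Qed.
#[global] Hint Resolve rlinear_id linear_id : core.

Section TensorLeft.
Variables (B R : pzRingType) (M : bimodType B R) (N : lmodType R).

Lemma rlinear_scale (b : B) : rlinear (fun m : M => b *: m).
Proof. by split=> [x y|m a]; rewrite ?scalerDr ?scale_ract. Qed.

Definition tscale (b : B) : tensor M N -> tensor M N :=
  tmap (fun m : M => b *: m) idfun.

Lemma tscaleE b m n : tscale b (m ⊗ n) = (b *: m) ⊗ n.
Proof. by rewrite /tscale tmapE //; apply: rlinear_scale. Qed.

Lemma tscaleDr : right_distributive tscale +%R.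
Proof. by move=> b; apply: tmapD => //; apply: rlinear_scale. Qed.

Lemma tscaleA a b t : tscale a (tscale b t) = tscale (a * b) t.
Proof.
elim/tensor_ind: t => [m n|s t IHs IHt]; first by rewrite !tscaleE scalerA.
by rewrite !tscaleDr IHs IHt.
Qed.

Lemma tscale1 : left_id 1 tscale.
Proof.
elim/tensor_ind => [m n|s t IHs IHt]; first by rewrite tscaleE scale1r.
by rewrite tscaleDr IHs IHt.
Qed.

Lemma tscaleDl t : {morph tscale^~ t : a b / a + b}.
Proof.
move=> a b; elim/tensor_ind: t => [m n|s t IHs IHt].
  by rewrite !tscaleE scalerDl tensDl.
by rewrite !tscaleDr IHs IHt addrACA.
Qed.

HB.instance Definition _ := GRing.Zmodule_isLmodule.Build B (tensor M N)
  tscaleA tscale1 tscaleDr tscaleDl.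

Lemma tensZ b m n : b *: (m ⊗ n) = (b *: m) ⊗ n.
Proof. exact: tscaleE. Qed.

End TensorLeft.

Section TensorRight.
Variables (R T : pzRingType) (M : rmodType R) (N : bimodType R T).

Lemma linear_ract (a : T) : linear (fun n : N => n :* a).
Proof. by move=> r x y; rewrite ractDl scale_ract. Qed.

Definition tract (t : tensor M N) (a : T) : tensor M N :=
  tmap idfun (fun n : N => n :* a) t.

Lemma tractE m n a : tract (m ⊗ n) a = m ⊗ (n :* a).
Proof. by rewrite /tract tmapE //; apply: linear_ract. Qed.

Lemma tractDl a : {morph tract^~ a : x y / x + y}.
Proof. by apply: tmapD => //; apply: linear_ract. Qed.

Lemma tractA t a b : tract (tract t a) b = tract t (a * b).
Proof.
elim/tensor_ind: t => [m n|s t IHs IHt]; first by rewrite !tractE ractA.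
by rewrite !tractDl IHs IHt.
Qed.

Lemma tract1 t : tract t 1 = t.
Proof.
elim/tensor_ind: t => [m n|s t IHs IHt]; first by rewrite tractE ract1.
by rewrite tractDl IHs IHt.
Qed.

Lemma tractDr t : {morph tract t : a b / a + b}.
Proof.
move=> a b; elim/tensor_ind: t => [m n|s t IHs IHt].
  by rewrite !tractE ractDr tensDr.
by rewrite !tractDl IHs IHt addrACA.
Qed.

HB.instance Definition _ := Zmodule_isRmodule.Build T (tensor M N)
  tractA tract1 tractDl tractDr.

Lemma tens_ract m n a : (m ⊗ n) :* a = m ⊗ (n :* a).
Proof. exact: tractE. Qed.

End TensorRight.

Section TensorBimodule.
Variables (B R T : pzRingType) (M : bimodType B R) (N : bimodType R T).

Lemma tensor_scale_ract (b : B) (t : tensor M N) (a : T) :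
  b *: (t :* a) = (b *: t) :* a.
Proof.
elim/tensor_ind: t => [m n|s t IHs IHt].
  by rewrite tens_ract !tensZ tens_ract.
by rewrite ractDl !scalerDr IHs IHt ractDl.
Qed.

HB.instance Definition _ :=
  LRmodule_isBimodule.Build B T (tensor M N) tensor_scale_ract.

End TensorBimodule.

Definition tassoc (R T : pzRingType) (M : rmodType R) (N : bimodType R T)
    (P : lmodType T) :
    tensor [the rmodType T of tensor M N] P -> tensor M [the lmodType R of tensor N P] :=
  tlift (fun t p => tlift (fun m n => m ⊗ (n ⊗ p)) t).

Record coring (k : comPzRingType) (A : algType k) := Coring {
  coring_sort :> bimodType A A;
  comul : coring_sort -> tensor coring_sort coring_sort;
  counit : coring_sort -> A;
  coring_central : forall (c : k) (x : coring_sort), c%:A *: x = x :* c%:A;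
  comulD : {morph comul : x y / x + y};
  comulZ : forall a x, comul (a *: x) = a *: comul x;
  comul_ract : forall x a, comul (x :* a) = comul x :* a;
  counitD : {morph counit : x y / x + y};
  counitZ : forall a x, counit (a *: x) = a * counit x;
  counit_ract : forall x a, counit (x :* a) = counit x * a;
  comulA : forall x, tassoc (tmap comul idfun (comul x)) = tmap idfun comul (comul x);
  comul_counitl : forall x, tlift (fun y z => counit y *: z) (comul x) = x;
  comul_counitr : forall x, tlift (fun y z => y :* counit z) (comul x) = x }.

Record comodule (k : comPzRingType) (A : algType k) (C : coring A) := Comodule {
  comodule_sort :> rmodType A;
  coact : comodule_sort -> tensor comodule_sort C;
  coactD : {morph coact : x y / x + y};
  coact_ract : forall x a, coact (x :* a) = coact x :* a;
  coactA : forall x,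
    tassoc (tmap coact idfun (coact x)) = tmap idfun (@comul _ _ C) (coact x);
  coact_counit : forall x, tlift (fun m c => m :* counit c) (coact x) = x }.

Section TensorMapTheory.
Variables (R : pzRingType).

Lemma rlinear_comp (M1 M2 M3 : rmodType R) (f : M2 -> M3) (g : M1 -> M2) :
  rlinear f -> rlinear g -> rlinear (f \o g).
Proof. by move=> [fD fA] [gD gA]; split=> [x y|m a] /=; rewrite ?gD ?fD ?gA ?fA. Qed.

Lemma linear_comp (N1 N2 N3 : lmodType R) (f : N2 -> N3) (g : N1 -> N2) :
  linear f -> linear g -> linear (f \o g).
Proof. by move=> fl gl a x y /=; rewrite gl fl. Qed.

Lemma tmap_comp (M1 M2 M3 : rmodType R) (N1 N2 N3 : lmodType R)
    (f : M2 -> M3) (g : N2 -> N3) (f' : M1 -> M2) (g' : N1 -> N2) :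
  rlinear f -> linear g -> rlinear f' -> linear g' ->
  forall t, tmap f g (tmap f' g' t) = tmap (f \o f') (g \o g') t.
Proof.
move=> fl gl fl' gl'; apply: tensor_ext => [x y|x y|m n].
- by rewrite !tmapD.
- by rewrite tmapD //; [exact: rlinear_comp|exact: linear_comp].
- rewrite !tmapE //; [exact: rlinear_comp|exact: linear_comp].
Qed.

Lemma eq_tmap (M M' : rmodType R) (N N' : lmodType R) (f f' : M -> M') (g g' : N -> N') :
  f =1 f' -> g =1 g' -> tmap f g =1 tmap f' g'.
Proof. by move=> /funext -> /funext ->. Qed.

Lemma tmap_id (M : rmodType R) (N : lmodType R) (t : tensor M N) :
  tmap idfun idfun t = t.
Proof.
by move: t; apply: tensor_ext => // [x y|m n]; rewrite ?tmapD // tmapE.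
Qed.

Lemma tmap_rlinear (T : pzRingType) (M M' : rmodType R) (N N' : bimodType R T)
    (f : M -> M') (g : N -> N') :
  rlinear f -> linear g -> rlinear g -> rlinear (tmap f g).
Proof.
move=> fl gl gr; split=> [|t a]; first exact: tmapD.
elim/tensor_ind: t => [m n|s t IHs IHt].
  by rewrite tens_ract !tmapE // tens_ract gr.2.
by rewrite ractDl !tmapD // IHs IHt ractDl.
Qed.

Lemma tmap_linear (B : pzRingType) (M M' : bimodType B R) (N N' : lmodType R)
    (f : M -> M') (g : N -> N') :
  rlinear f -> linear f -> linear g -> linear (tmap f g).
Proof.
move=> fr fl gl a x y; rewrite tmapD //; congr (_ + _).
elim/tensor_ind: x => [m n|s t IHs IHt].
  rewrite tensZ !tmapE // tensZ; congr (_ ⊗ _).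
  have f0 : f 0 = 0 by apply: (addIr (f 0)); rewrite -fr.1 !add0r.
  by have := fl a m 0; rewrite !addr0 f0 addr0.
by rewrite scalerDr !tmapD // IHs IHt scalerDr.
Qed.

End TensorMapTheory.

Section TensorAssoc.
Variables (R T : pzRingType) (M : rmodType R) (N : bimodType R T) (P : lmodType T).

Lemma tassoc_balanced2 p : balanced (fun (m : M) (n : N) => m ⊗ (n ⊗ p : tensor N P)).
Proof.
split=> [n m m'|m n n'|m a n]; first by rewrite tensDl.
  by rewrite tensDl tensDr.
by rewrite tensA tensZ.
Qed.

Lemma tassoc_balanced : balanced (fun (t : tensor M N) (p : P) =>
  tlift (fun m n => m ⊗ (n ⊗ p)) t).
Proof.
split=> [p|t p p'|t a p].
- exact/tliftD/tassoc_balanced2.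
- elim/tensor_ind: t => [m n|s t IHs IHt].
    by rewrite !tliftE; try exact: tassoc_balanced2; rewrite !tensDr.
  by rewrite !tliftD; try exact: tassoc_balanced2; rewrite IHs IHt addrACA.
- elim/tensor_ind: t => [m n|s t IHs IHt].
    by rewrite tens_ract !tliftE; try exact: tassoc_balanced2; rewrite tensA.
  by rewrite ractDl !tliftD; try exact: tassoc_balanced2; rewrite IHs IHt.
Qed.

Lemma tassocE m n p : @tassoc R T M N P ((m ⊗ n) ⊗ p) = m ⊗ (n ⊗ p).
Proof.
rewrite /tassoc tliftE; last exact: tassoc_balanced.
by rewrite tliftE //; apply: tassoc_balanced2.
Qed.

Lemma tassocD : {morph @tassoc R T M N P : x y / x + y}.
Proof. exact/tliftD/tassoc_balanced. Qed.

Lemma tensor3_ext (G : zmodType) (f g : tensor [the rmodType T of tensor M N] P -> G) :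
  {morph f : x y / x + y} -> {morph g : x y / x + y} ->
  (forall m n p, f ((m ⊗ n) ⊗ p) = g ((m ⊗ n) ⊗ p)) -> f =1 g.
Proof.
move=> fD gD fg; apply: tensor_ext => // t p.
elim/tensor_ind: t => [m n|s t IHs IHt]; first exact: fg.
by rewrite tensDl fD gD IHs IHt.
Qed.

End TensorAssoc.

Lemma tassoc_nat (R T : pzRingType) (M M' : rmodType R) (N N' : bimodType R T)
    (P P' : lmodType T) (f : M -> M') (g : N -> N') (h : P -> P') :
  rlinear f -> linear g -> rlinear g -> linear h ->
  forall t, tassoc (tmap (tmap f g) h t) = tmap f (tmap g h) (tassoc t).
Proof.
move=> fr gl gr hl; have fgr := tmap_rlinear fr gl gr.
have ghl := tmap_linear gr gl hl.
apply: tensor3_ext => [x y|x y|m n p].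
- by rewrite (tmapD fgr hl) tassocD.
- by rewrite tassocD (tmapD fr ghl).
- by rewrite tassocE (tmapE fgr hl) (tmapE fr gl) (tmapE fr ghl) (tmapE gr hl) tassocE.
Qed.

Section Comodules.
Variables (k : comPzRingType) (A : algType k) (C : coring A).

Lemma comul_linear : linear (@comul k A C).
Proof. by move=> a x y; rewrite comulD comulZ. Qed.

Lemma comul_rlinear : rlinear (@comul k A C).
Proof. by split; [apply: comulD|apply: comul_ract]. Qed.

Lemma coact_rlinear (M : comodule C) : rlinear (@coact k A C M).
Proof. by split; [apply: coactD|apply: coact_ract]. Qed.

Definition regular_comodule : comodule C :=
  Comodule (@comulD k A C) (@comul_ract k A C) (@comulA k A C) (@comul_counitr k A C).

Record colin (M N : comodule C) := Colin {
  colin_fun :> M -> N;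
  colin_rlinear : rlinear colin_fun;
  colin_coact : forall m, coact (colin_fun m) = tmap colin_fun idfun (coact m) }.

Lemma colin_eq (M N : comodule C) (f g : colin M N) : f =1 g -> f = g.
Proof.
case: f g => [f fl fc] [g gl gc] /= /funext fg.
by subst g; rewrite (Prop_irrelevance fl gl) (Prop_irrelevance fc gc).
Qed.

HB.instance Definition _ (M N : comodule C) := gen_eqMixin (colin M N).
HB.instance Definition _ (M N : comodule C) := gen_choiceMixin (colin M N).

Lemma coact0 (M : comodule C) : coact (0 : M) = 0.
Proof. by apply: (addIr (coact (0 : M))); rewrite -coactD !add0r. Qed.

Section ColinZmodule.
Variables M N : comodule C.
Implicit Types f g : colin M N.

Lemma colinD f : {morph f : x y / x + y}. Proof. by case: (colin_rlinear f). Qed.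
Lemma colin_ract f m a : f (m :* a) = f m :* a.
Proof. by case: (colin_rlinear f). Qed.

Lemma colin_zero_rlinear : rlinear (fun _ : M => 0 : N).
Proof.
split=> [x y|m a]; first by rewrite addr0.
by apply: (addIr ((0 : N) :* a)); rewrite add0r -ractDl addr0.
Qed.

Lemma colin_zero_coact m : coact (0 : N) = tmap (fun _ : M => 0 : N) idfun (coact m).
Proof.
rewrite coact0; elim/tensor_ind: (coact m) => [x c|s t IHs IHt].
  by rewrite tmapE ?tens0l //; exact: colin_zero_rlinear.
by rewrite tmapD -?IHs -?IHt ?addr0 //; exact: colin_zero_rlinear.
Qed.

Definition colin_zero : colin M N := Colin colin_zero_rlinear colin_zero_coact.

Lemma colin_add_rlinear f g : rlinear (fun m => f m + g m).
Proof. by split=> [x y|m a]; rewrite ?colinD ?colin_ract ?ractDl // addrACA. Qed.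

Lemma colin_add_coact f g m :
  coact (f m + g m) = tmap (fun m => f m + g m) idfun (coact m).
Proof.
rewrite coactD !colin_coact; elim/tensor_ind: (coact m) => [x c|s t IHs IHt].
  rewrite !tmapE ?tensDl //; [exact: colin_add_rlinear|exact: colin_rlinear..].
rewrite !tmapD; try exact: colin_rlinear; try exact: colin_add_rlinear; try exact: linear_id.
by rewrite addrACA IHs IHt.
Qed.

Definition colin_add f g : colin M N :=
  Colin (colin_add_rlinear f g) (colin_add_coact f g).

Lemma ractNl (x : N) a : (- x) :* a = - (x :* a).
Proof.
have r0 : (0 : N) :* a = 0 by apply: (addIr (0 :* a)); rewrite -ractDl !add0r.
by apply: (addIr (x :* a)); rewrite -ractDl !addNr.
Qed.

Lemma colin_opp_rlinear f : rlinear (fun m => - f m).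
Proof. by split=> [x y|m a]; rewrite ?colinD ?opprD // colin_ract ractNl. Qed.

Lemma colin_opp_coact f m : coact (- f m) = tmap (fun m => - f m) idfun (coact m).
Proof.
have -> : coact (- f m) = - coact (f m).
  by apply: (addIr (coact (f m))); rewrite -coactD !addNr coact0.
rewrite colin_coact; elim/tensor_ind: (coact m) => [x c|s t IHs IHt].
  rewrite !tmapE ?tensNl //; [exact: colin_opp_rlinear|exact: colin_rlinear].
rewrite !tmapD; try exact: colin_rlinear; try exact: colin_opp_rlinear; try exact: linear_id.
by rewrite opprD IHs IHt.
Qed.

Definition colin_opp f : colin M N := Colin (colin_opp_rlinear f) (colin_opp_coact f).

Lemma colin_addA : associative colin_add.
Proof. by move=> f g h; apply: colin_eq => m /=; rewrite addrA. Qed.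
Lemma colin_addC : commutative colin_add.
Proof. by move=> f g; apply: colin_eq => m /=; rewrite addrC. Qed.
Lemma colin_add0 : left_id colin_zero colin_add.
Proof. by move=> f; apply: colin_eq => m /=; rewrite add0r. Qed.
Lemma colin_addN : left_inverse colin_zero colin_opp colin_add.
Proof. by move=> f; apply: colin_eq => m /=; rewrite addNr. Qed.

HB.instance Definition _ := GRing.isZmodule.Build (colin M N)
  colin_addA colin_addC colin_add0 colin_addN.

Lemma colin_addE f g m : (f + g) m = f m + g m. Proof. by []. Qed.
Lemma colin_zeroE m : (0 : colin M N) m = 0. Proof. by []. Qed.

End ColinZmodule.

Lemma colin_id_coact (M : comodule C) (m : M) : coact m = tmap idfun idfun (coact m).
Proof. by rewrite tmap_id. Qed.

Definition colin_id (M : comodule C) : colin M M :=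
  Colin (@rlinear_id _ M) (@colin_id_coact M).

Lemma colin_comp_coact (M N P : comodule C) (f : colin N P) (g : colin M N) (m : M) :
  coact (f (g m)) = tmap (f \o g) idfun (coact m).
Proof.
rewrite !colin_coact tmap_comp //; exact: colin_rlinear.
Qed.

Definition colin_comp (M N P : comodule C) (f : colin N P) (g : colin M N) : colin M P :=
  @Colin M P (f \o g) (rlinear_comp (colin_rlinear f) (colin_rlinear g)) (colin_comp_coact f g).

Section ColinRing.
Variable M : comodule C.

Lemma colin_compA : associative (@colin_comp M M M).
Proof. by move=> f g h; apply: colin_eq. Qed.
Lemma colin_comp1l : left_id (colin_id M) (@colin_comp M M M).
Proof. by move=> f; apply: colin_eq. Qed.
Lemma colin_comp1r : right_id (colin_id M) (@colin_comp M M M).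
Proof. by move=> f; apply: colin_eq. Qed.
Lemma colin_compDl : left_distributive (@colin_comp M M M) +%R.
Proof. by move=> f g h; apply: colin_eq. Qed.
Lemma colin_compDr : right_distributive (@colin_comp M M M) +%R.
Proof. by move=> f g h; apply: colin_eq => m /=; rewrite colinD. Qed.

HB.instance Definition _ := GRing.Zmodule_isPzRing.Build (colin M M)
  colin_compA colin_comp1l colin_comp1r colin_compDl colin_compDr.

End ColinRing.

Section ColinRmodule.
Variables M N : comodule C.

Definition colin_ractS (f : colin M N) (s : colin M M) := colin_comp f s.

Lemma colin_ractSA f s t : colin_ractS (colin_ractS f s) t = colin_ractS f (s * t).
Proof. exact: colin_eq. Qed.
Lemma colin_ractS1 f : colin_ractS f 1 = f.
Proof. exact: colin_eq. Qed.
Lemma colin_ractSDl s : {morph colin_ractS^~ s : f g / f + g}.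
Proof. by move=> f g; apply: colin_eq. Qed.
Lemma colin_ractSDr f : {morph colin_ractS f : s t / s + t}.
Proof. by move=> s t; apply: colin_eq => m /=; rewrite colinD. Qed.

HB.instance Definition _ := Zmodule_isRmodule.Build (colin M M) (colin M N)
  colin_ractSA colin_ractS1 colin_ractSDl colin_ractSDr.

End ColinRmodule.

(* An alias of M, which carries the (End^C(M), A)-bimodule structure: s *: m = s m *)
Definition endmod (M : comodule C) : Type := M.

Section Endmod.
Variable M : comodule C.

HB.instance Definition _ := Rmodule.on (endmod M).

Definition endmod_scale (s : colin M M) (m : endmod M) : endmod M := s m.

Lemma endmod_scaleA s t m : endmod_scale s (endmod_scale t m) = endmod_scale (s * t) m.
Proof. by []. Qed.
Lemma endmod_scale1 : left_id 1 endmod_scale.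
Proof. by []. Qed.
Lemma endmod_scaleDr : right_distributive endmod_scale +%R.
Proof. by move=> s m n; exact: colinD. Qed.
Lemma endmod_scaleDl m : {morph endmod_scale^~ m : s t / s + t}.
Proof. by []. Qed.
HB.instance Definition _ := GRing.Zmodule_isLmodule.Build (colin M M) (endmod M)
  endmod_scaleA endmod_scale1 endmod_scaleDr endmod_scaleDl.

Lemma endmod_scale_ract (s : colin M M) (m : endmod M) (a : A) :
  s *: (m :* a) = (s *: m) :* a.
Proof. exact: colin_ract. Qed.
HB.instance Definition _ :=
  LRmodule_isBimodule.Build (colin M M) A (endmod M) endmod_scale_ract.

End Endmod.

End Comodules.

Section HomTensorEvaluation.
Variables (k : comPzRingType) (A : algType k) (C : coring A).

Lemma endmod_coactZ (M : comodule C) (s : colin M M) (m : endmod M) :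
  coact (s *: m : M) = tmap s idfun (coact (m : M)).
Proof. exact: colin_coact. Qed.

Section HomTensor.
Variables M N : comodule C.

Definition hom_tensor_coact : tensor (colin M N) (endmod M) ->
    tensor [the rmodType A of tensor (colin M N) (endmod M)] C :=
  tlift (fun (f : colin M N) (m : endmod M) =>
    tmap (fun m0 : M => f ⊗ (m0 : endmod M)) idfun (coact (m : M))).

Lemma hom_tens_rlinear (f : colin M N) :
  rlinear (fun m0 : M => f ⊗ (m0 : endmod M)).
Proof. by split=> [x y|m a]; [exact: tensDr|rewrite tens_ract]. Qed.

Lemma hom_tensor_coact_balanced : balanced (fun (f : colin M N) (m : endmod M) =>
  tmap (fun m0 : M => f ⊗ (m0 : endmod M)) idfun (coact (m : M))).
Proof.
split=> [m f g|f m n|f s m].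
- elim/tensor_ind: (coact _) => [m0 c|u v IHu IHv].
    rewrite !tmapE; try exact: hom_tens_rlinear; try exact: linear_id.
    by rewrite !tensDl.
  rewrite !tmapD; try exact: hom_tens_rlinear; try exact: linear_id.
  by rewrite IHu IHv addrACA.
- by rewrite coactD tmapD //; apply: hom_tens_rlinear.
- rewrite endmod_coactZ tmap_comp; try exact: linear_id.
  + by apply: eq_tmap => // m0 /=; rewrite tensA.
  + exact: hom_tens_rlinear.
  + exact: colin_rlinear.
Qed.

Lemma hom_tensor_coactE (f : colin M N) (m : endmod M) : hom_tensor_coact (f ⊗ m) =
  tmap (fun m0 : M => f ⊗ (m0 : endmod M)) idfun (coact (m : M)).
Proof. exact: (tliftE hom_tensor_coact_balanced). Qed.

Lemma hom_tensor_coactD : {morph hom_tensor_coact : x y / x + y}.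
Proof. exact: (tliftD hom_tensor_coact_balanced). Qed.

Lemma hom_tensor_coact_ract x a : hom_tensor_coact (x :* a) = hom_tensor_coact x :* a.
Proof.
elim/tensor_ind: x => [f m|u v IHu IHv].
  rewrite tens_ract !hom_tensor_coactE coact_ract.
  by apply: (tmap_rlinear (hom_tens_rlinear f) _ _).2.
by rewrite ractDl !hom_tensor_coactD IHu IHv ractDl.
Qed.

Lemma hom_tensor_coact_rlinear : rlinear hom_tensor_coact.
Proof. by split; [exact: hom_tensor_coactD|exact: hom_tensor_coact_ract]. Qed.

Lemma coassoc_transport (M0 N0 : rmodType A) (D : bimodType A A)
    (Delta : D -> tensor D D) (rho : M0 -> tensor M0 D) (rhoN : N0 -> tensor N0 D)
    (j : M0 -> N0) (m : M0) :
  linear Delta -> rlinear Delta -> rlinear rho -> rlinear rhoN -> rlinear j ->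
  (forall m, rhoN (j m) = tmap j idfun (rho m)) ->
  tassoc (tmap rho idfun (rho m)) = tmap idfun Delta (rho m) ->
  tassoc (tmap rhoN idfun (rhoN (j m))) = tmap idfun Delta (rhoN (j m)).
Proof.
move=> Dl Dr rhor rhoNr jr rhoj rhoA.
have lid := @linear_id _ D.
have jid : rlinear (tmap j (@idfun D)) by apply: tmap_rlinear.
have idid : linear (tmap (@idfun D) (@idfun D)) by apply: tmap_linear.
rewrite rhoj (tmap_comp rhoNr lid jr lid) (tmap_comp (@rlinear_id _ N0) Dl jr lid).
rewrite (@eq_tmap _ _ _ _ _ _ (tmap j idfun \o rho) _ (idfun \o idfun)) //.
rewrite -(tmap_comp jid lid rhor lid) (tassoc_nat jr lid (@rlinear_id _ D) lid).
rewrite rhoA (tmap_comp jr idid (@rlinear_id _ M0) Dl).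
by apply: eq_tmap => // d /=; rewrite tmap_id.
Qed.

Lemma hom_tensor_coactA x :
  tassoc (tmap hom_tensor_coact idfun (hom_tensor_coact x)) =
  tmap idfun (@comul k A C) (hom_tensor_coact x).
Proof.
have Hr := hom_tensor_coact_rlinear; have lC := @comul_linear k A C.
have Hid : rlinear (@idfun (tensor (colin M N) (endmod M))) by [].
elim/tensor_ind: x => [f m|u v IHu IHv].
  have fE (m0 : M) : hom_tensor_coact (f ⊗ (m0 : endmod M)) =
      tmap (fun m0 : M => f ⊗ (m0 : endmod M)) idfun (coact m0).
    exact: hom_tensor_coactE.
  exact: (coassoc_transport lC (@comul_rlinear k A C) (coact_rlinear M) Hr
    (hom_tens_rlinear f) fE (coactA (m : M))).
rewrite !hom_tensor_coactD (tmapD Hr (@linear_id _ C)) tassocD (tmapD Hid lC).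
by rewrite IHu IHv.
Qed.

Lemma counit_balanced (M0 : rmodType A) : balanced (fun (m : M0) (c : C) => m :* counit c).
Proof.
split=> [c m m'|m c c'|m a c]; first exact: ractDl.
  by rewrite counitD ractDr.
by rewrite counitZ ractA.
Qed.

Lemma hom_tensor_coact_counit x :
  tlift (fun y c => y :* counit c) (hom_tensor_coact x) = x.
Proof.
elim/tensor_ind: x => [f m|u v IHu IHv].
  rewrite hom_tensor_coactE -[in RHS](coact_counit (m : M)).
  have fr := hom_tens_rlinear f.
  elim/tensor_ind: (coact _) => [m0 c|u v IHu IHv].
    rewrite (tmapE fr (@linear_id _ C)) !tliftE; try exact: counit_balanced.
    by rewrite tens_ract.
  rewrite (tmapD fr (@linear_id _ C)) !tliftD; try exact: counit_balanced.
  by rewrite IHu IHv tensDr.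
by rewrite hom_tensor_coactD tliftD ?IHu ?IHv //; apply: counit_balanced.
Qed.

Definition hom_tensor : comodule C :=
  Comodule hom_tensor_coactD hom_tensor_coact_ract hom_tensor_coactA hom_tensor_coact_counit.

Definition ev (t : hom_tensor) : N := tlift (fun (f : colin M N) (m : endmod M) => f m) t.

Lemma ev_balanced : balanced (fun (f : colin M N) (m : endmod M) => f m).
Proof. by split=> // f m n; exact: colinD. Qed.

Lemma evE (f : colin M N) (m : endmod M) : ev (f ⊗ m) = f m.
Proof. exact: (tliftE ev_balanced). Qed.

Lemma ev_rlinear : rlinear ev.
Proof.
split=> [|x a]; first exact: (tliftD ev_balanced).
elim/tensor_ind: x => [f m|u v IHu IHv].
  by rewrite tens_ract !evE; exact: colin_ract.
by rewrite ractDl /ev !(tliftD ev_balanced) [LHS](congr2 +%R IHu IHv) ractDl.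
Qed.

Lemma ev_coact x : coact (ev x) = tmap ev idfun (coact x).
Proof.
have lid := @linear_id _ C; have er := ev_rlinear.
elim/tensor_ind: x => [f m|u v IHu IHv].
  rewrite evE colin_coact.
  have -> : @coact k A C hom_tensor (f ⊗ m) = _ := hom_tensor_coactE f m.
  rewrite (tmap_comp er lid (hom_tens_rlinear f) lid).
  by apply: eq_tmap => // m0 /=; rewrite evE.
rewrite [ev _]er.1 coactD.
have -> : @coact k A C hom_tensor (u + v) =
  @coact k A C hom_tensor u + @coact k A C hom_tensor v := hom_tensor_coactD u v.
by rewrite (tmapD er lid) IHu IHv.
Qed.

Definition evaluation : colin hom_tensor N := Colin ev_rlinear ev_coact.

End HomTensor.

End HomTensorEvaluation.

Lemma morph_sum (V W : zmodType) (f : V -> W) : {morph f : x y / x + y} ->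
  forall (I : Type) (r : seq I) (P : pred I) (F : I -> V),
  f (\sum_(i <- r | P i) F i) = \sum_(i <- r | P i) f (F i).
Proof.
move=> fD I r P F; apply: (big_morph f fD).
by apply: (addIr (f 0)); rewrite -fD !add0r.
Qed.

Record dual (A : pzRingType) (M : rmodType A) := Dual {
  dual_fun :> M -> A;
  dualD : {morph dual_fun : x y / x + y};
  dual_ract : forall m a, dual_fun (m :* a) = dual_fun m * a }.

Section DualLmodule.
Variables (A : pzRingType) (M : rmodType A).
Implicit Types xi zeta : dual M.

Lemma dual_eq xi zeta : xi =1 zeta -> xi = zeta.
Proof.
case: xi zeta => [f fD fr] [g gD gr] /= /funext fg.
by subst g; rewrite (Prop_irrelevance fD gD) (Prop_irrelevance fr gr).
Qed.

HB.instance Definition _ := gen_eqMixin (dual M).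
HB.instance Definition _ := gen_choiceMixin (dual M).

Definition dual_zero : dual M.
Proof.
by exists (fun=> 0) => [x y|m a]; rewrite ?addr0 ?mul0r.
Defined.

Definition dual_add xi zeta : dual M.
Proof.
exists (fun m => xi m + zeta m) => [x y|m a]; first by rewrite !dualD addrACA.
by rewrite !dual_ract mulrDl.
Defined.

Definition dual_opp xi : dual M.
Proof.
exists (fun m => - xi m) => [x y|m a]; first by rewrite dualD opprD.
by rewrite dual_ract mulNr.
Defined.

Definition dual_scale (a : A) xi : dual M.
Proof.
exists (fun m => a * xi m) => [x y|m b]; first by rewrite dualD mulrDr.
by rewrite dual_ract mulrA.
Defined.

Lemma dual_addA : associative dual_add.
Proof. by move=> f g h; apply: dual_eq => m /=; rewrite addrA. Qed.
Lemma dual_addC : commutative dual_add.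
Proof. by move=> f g; apply: dual_eq => m /=; rewrite addrC. Qed.
Lemma dual_add0 : left_id dual_zero dual_add.
Proof. by move=> f; apply: dual_eq => m /=; rewrite add0r. Qed.
Lemma dual_addN : left_inverse dual_zero dual_opp dual_add.
Proof. by move=> f; apply: dual_eq => m /=; rewrite addNr. Qed.

HB.instance Definition _ := GRing.isZmodule.Build (dual M)
  dual_addA dual_addC dual_add0 dual_addN.

Lemma dual_scaleA a b xi : dual_scale a (dual_scale b xi) = dual_scale (a * b) xi.
Proof. by apply: dual_eq => m /=; rewrite mulrA. Qed.
Lemma dual_scale1 : left_id 1 dual_scale.
Proof. by move=> f; apply: dual_eq => m /=; rewrite mul1r. Qed.
Lemma dual_scaleDr : right_distributive dual_scale +%R.
Proof. by move=> a f g; apply: dual_eq => m /=; rewrite mulrDr. Qed.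
Lemma dual_scaleDl xi : {morph dual_scale^~ xi : a b / a + b}.
Proof. by move=> a b; apply: dual_eq => m /=; rewrite mulrDl. Qed.

HB.instance Definition _ := GRing.Zmodule_isLmodule.Build A (dual M)
  dual_scaleA dual_scale1 dual_scaleDr dual_scaleDl.

Lemma dual_sumE (I : Type) (r : seq I) (P : pred I) (F : I -> dual M) m :
  (\sum_(i <- r | P i) F i) m = \sum_(i <- r | P i) F i m.
Proof. exact: (big_morph (fun xi : dual M => xi m)). Qed.

Definition dual_basis (n : nat) (e : 'I_n -> M) (xi : 'I_n -> dual M) :=
  forall m, m = \sum_i e i :* xi i m.

Lemma ract_suml (I : Type) (r : seq I) (P : pred I) (F : I -> M) (a : A) :
  (\sum_(i <- r | P i) F i) :* a = \sum_(i <- r | P i) F i :* a.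
Proof. exact: (morph_sum (ractDl a)). Qed.

Lemma dual_expand n (e : 'I_n -> M) (xi : 'I_n -> dual M) : dual_basis e xi ->
  forall zeta, zeta = \sum_i zeta (e i) *: xi i.
Proof.
move=> eP zeta; apply: dual_eq => m; rewrite {1}(eP m) dual_sumE.
rewrite (morph_sum (dualD zeta)).
by apply: eq_bigr => i _; rewrite dual_ract.
Qed.

End DualLmodule.

Section DualBimodule.
Variables (k : comPzRingType) (A : algType k) (C : coring A) (M : comodule C).

Definition dual_ractS (xi : dual M) (s : colin M M) : dual M.
Proof.
exists (fun m => xi (s m)) => [x y|m a]; first by rewrite colinD dualD.
by rewrite colin_ract dual_ract.
Defined.

Lemma dual_ractSA xi s t : dual_ractS (dual_ractS xi s) t = dual_ractS xi (s * t).
Proof. exact: dual_eq. Qed.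
Lemma dual_ractS1 xi : dual_ractS xi 1 = xi.
Proof. exact: dual_eq. Qed.
Lemma dual_ractSDl s : {morph dual_ractS^~ s : x y / x + y}.
Proof. by move=> x y; apply: dual_eq. Qed.
Lemma dual_ractSDr xi : {morph dual_ractS xi : s t / s + t}.
Proof. by move=> s t; apply: dual_eq => m /=; rewrite dualD. Qed.

HB.instance Definition _ := Zmodule_isRmodule.Build (colin M M) (dual M)
  dual_ractSA dual_ractS1 dual_ractSDl dual_ractSDr.

Lemma dual_scale_ract (a : A) (xi : dual M) (s : colin M M) :
  a *: (xi :* s) = (a *: xi) :* s.
Proof. exact: dual_eq. Qed.

HB.instance Definition _ :=
  LRmodule_isBimodule.Build A (colin M M) (dual M) dual_scale_ract.

End DualBimodule.

Section Comatrix.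
Variables (k : comPzRingType) (A : algType k) (C : coring A) (M : comodule C).
Variables (n : nat) (e : 'I_n -> M) (xi : 'I_n -> dual M).
Hypothesis exi : dual_basis e xi.

Local Notation D := [the bimodType A A of tensor (dual M) (endmod M)].

Definition comatrix_comul : D -> tensor D D :=
  tlift (fun (zeta : dual M) (m : endmod M) =>
    \sum_i ((zeta ⊗ (e i : endmod M) : D) ⊗ (xi i ⊗ m : D))).

Definition comatrix_counit : D -> A :=
  tlift (fun (zeta : dual M) (m : endmod M) => zeta m).

Lemma comatrix_coact_scale (s : colin M M) (m : endmod M) :
  \sum_i (e i ⊗ (xi i ⊗ (s *: m) : D)) =
  \sum_i (s (e i) ⊗ (xi i ⊗ m : D)) :> tensor M D.
Proof.
transitivity (\sum_i \sum_j (e i :* xi i (s (e j))) ⊗ (xi j ⊗ m : D)).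
  apply: eq_bigr => i _; rewrite -tensA (dual_expand exi (xi i :* s)).
  rewrite tens_suml tens_sumr; apply: eq_bigr => j _.
  by rewrite -tensZ tensA.
rewrite exchange_big; apply: eq_bigr => j _.
by rewrite [in RHS](exi (s (e j))) tens_suml.
Qed.

Lemma tens_dual_rlinear (zeta : dual M) : rlinear (fun m : M => zeta ⊗ (m : endmod M) : D).
Proof. by split=> [x y|m a]; [exact: tensDr|rewrite tens_ract]. Qed.

Lemma comatrix_comul_balanced : balanced (fun (zeta : dual M) (m : endmod M) =>
  \sum_i ((zeta ⊗ (e i : endmod M) : D) ⊗ (xi i ⊗ m : D))).
Proof.
split=> [m z z'|z m m'|z s m].
- by rewrite -big_split; apply: eq_bigr => i _; rewrite /= !tensDl.
- by rewrite -big_split; apply: eq_bigr => i _; rewrite /= !tensDr.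
- have lD := @linear_id _ D; have zr := tens_dual_rlinear z.
  have := congr1 (tmap (fun m : M => z ⊗ (m : endmod M) : D) idfun)
    (comatrix_coact_scale s m).
  rewrite !(morph_sum (tmapD zr lD)) => E; apply: etrans (etrans _ (esym E)) _.
  + by apply: eq_bigr => i _; rewrite (tmapE zr lD) tensA.
  + by apply: eq_bigr => i _; rewrite (tmapE zr lD).
Qed.

Lemma comatrix_comulE (zeta : dual M) (m : endmod M) : comatrix_comul (zeta ⊗ m) =
  \sum_i ((zeta ⊗ (e i : endmod M) : D) ⊗ (xi i ⊗ m : D)).
Proof. exact: (tliftE comatrix_comul_balanced). Qed.

Lemma comatrix_comulD : {morph comatrix_comul : x y / x + y}.
Proof. exact: (tliftD comatrix_comul_balanced). Qed.

Lemma comatrix_comulZ a x : comatrix_comul (a *: x) = a *: comatrix_comul x.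
Proof.
elim/tensor_ind: x => [z m|u v IHu IHv].
  rewrite tensZ !comatrix_comulE scaler_sumr.
  by apply: eq_bigr => i _; rewrite tensZ tensZ.
by rewrite scalerDr !comatrix_comulD IHu IHv scalerDr.
Qed.

Lemma comatrix_comul_ract x a : comatrix_comul (x :* a) = comatrix_comul x :* a.
Proof.
elim/tensor_ind: x => [z m|u v IHu IHv].
  rewrite tens_ract !comatrix_comulE ract_suml.
  by apply: eq_bigr => i _; rewrite tens_ract tens_ract.
by rewrite ractDl !comatrix_comulD IHu IHv ractDl.
Qed.

Lemma comatrix_counit_balanced : balanced (fun (zeta : dual M) (m : endmod M) => zeta m).
Proof. by split=> // z m m'; exact: dualD. Qed.

Lemma comatrix_counitE (zeta : dual M) (m : endmod M) :
  comatrix_counit (zeta ⊗ m) = zeta m.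
Proof. exact: (tliftE comatrix_counit_balanced). Qed.

Lemma comatrix_counitD : {morph comatrix_counit : x y / x + y}.
Proof. exact: (tliftD comatrix_counit_balanced). Qed.

Lemma comatrix_counitZ a x : comatrix_counit (a *: x) = a * comatrix_counit x.
Proof.
elim/tensor_ind: x => [z m|u v IHu IHv]; first by rewrite tensZ !comatrix_counitE.
by rewrite scalerDr !comatrix_counitD IHu IHv mulrDr.
Qed.

Lemma comatrix_counit_ract x a : comatrix_counit (x :* a) = comatrix_counit x * a.
Proof.
elim/tensor_ind: x => [z m|u v IHu IHv].
  by rewrite tens_ract !comatrix_counitE; exact: dual_ract.
by rewrite ractDl !comatrix_counitD IHu IHv mulrDl.
Qed.

Lemma homothety_rlinear (c : k) : rlinear (fun m : M => m :* c%:A).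
Proof. by split=> [x y|m a]; rewrite ?ractDl // !ractA mulr_algr mulr_algl. Qed.

Lemma homothety_coact (c : k) (m : M) :
  coact (m :* c%:A) = tmap (fun m : M => m :* c%:A) idfun (coact m).
Proof.
rewrite coact_ract; have cr := homothety_rlinear c; have lC := @linear_id _ C.
elim/tensor_ind: (coact m) => [x y|u v IHu IHv].
  by rewrite tens_ract (tmapE cr lC) tensA coring_central.
by rewrite ractDl (tmapD cr lC) IHu IHv.
Qed.

Definition homothety (c : k) : colin M M := Colin (homothety_rlinear c) (homothety_coact c).

Lemma comatrix_central (c : k) (x : D) : c%:A *: x = x :* c%:A.
Proof.
elim/tensor_ind: x => [z m|u v IHu IHv]; last by rewrite scalerDr ractDl IHu IHv.
rewrite tensZ tens_ract; have -> : m :* c%:A = homothety c *: m by [].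
rewrite -tensA; congr (_ ⊗ _); apply: dual_eq => x /=.
by rewrite dual_ract mulr_algl mulr_algr.
Qed.

Lemma comatrix_comulA x : tassoc (tmap comatrix_comul idfun (comatrix_comul x)) =
  tmap idfun comatrix_comul (comatrix_comul x).
Proof.
have Dr : rlinear comatrix_comul.
  by split; [exact: comatrix_comulD|exact: comatrix_comul_ract].
have Dl : linear comatrix_comul.
  by move=> a u v; rewrite comatrix_comulD comatrix_comulZ.
have lD := @linear_id _ D; have rD := @rlinear_id _ D.
elim/tensor_ind: x => [z m|u v IHu IHv].
  rewrite comatrix_comulE (morph_sum (tmapD Dr lD)) (morph_sum (tmapD rD Dl)).
  rewrite (morph_sum (@tassocD _ _ _ _ _)).
  under eq_bigr => i _.
    rewrite (tmapE Dr lD) comatrix_comulE tens_suml (morph_sum (@tassocD _ _ _ _ _)).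
    under eq_bigr => j _ do rewrite tassocE.
    over.
  rewrite exchange_big; apply: eq_bigr => j _.
  by rewrite (tmapE rD Dl) comatrix_comulE tens_sumr.
by rewrite !comatrix_comulD (tmapD Dr lD) tassocD (tmapD rD Dl) IHu IHv.
Qed.

Lemma counitl_balanced : balanced (fun x y : D => comatrix_counit x *: y).
Proof.
split=> [y x x'|x y y'|x a y]; first by rewrite comatrix_counitD scalerDl.
  by rewrite scalerDr.
by rewrite comatrix_counit_ract scalerA.
Qed.

Lemma counitr_balanced : balanced (fun x y : D => x :* comatrix_counit y).
Proof.
split=> [y x x'|x y y'|x a y]; first by rewrite ractDl.
  by rewrite comatrix_counitD ractDr.
by rewrite comatrix_counitZ ractA.
Qed.

Lemma comatrix_counitl x :
  tlift (fun y z : D => comatrix_counit y *: z) (comatrix_comul x) = x.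
Proof.
elim/tensor_ind: x => [z m|u v IHu IHv].
  rewrite comatrix_comulE (morph_sum (tliftD counitl_balanced)).
    rewrite [in RHS](dual_expand exi z) tens_suml; apply: eq_bigr => i _.
    by rewrite (tliftE counitl_balanced) comatrix_counitE tensZ.
by rewrite comatrix_comulD (tliftD counitl_balanced) IHu IHv.
Qed.

Lemma comatrix_counitr x :
  tlift (fun y z : D => y :* comatrix_counit z) (comatrix_comul x) = x.
Proof.
elim/tensor_ind: x => [z m|u v IHu IHv].
  rewrite comatrix_comulE (morph_sum (tliftD counitr_balanced)).
    rewrite [in RHS](exi m) tens_sumr; apply: eq_bigr => i _.
    by rewrite (tliftE counitr_balanced) comatrix_counitE tens_ract.
by rewrite comatrix_comulD (tliftD counitr_balanced) IHu IHv.
Qed.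

Definition comatrix_coring : coring A :=
  Coring comatrix_central comatrix_comulD comatrix_comulZ comatrix_comul_ract
    comatrix_counitD comatrix_counitZ comatrix_counit_ract
    comatrix_comulA comatrix_counitl comatrix_counitr.

End Comatrix.

Definition can_map (k : comPzRingType) (A : algType k) (C : coring A) (M : comodule C) :
    tensor (dual M) (endmod M) -> C :=
  tlift (fun (xi : dual M) (m : endmod M) =>
    tlift (fun (m0 : M) (m1 : C) => xi m0 *: m1) (coact (m : M))).

Definition surjection (X Y : Type) (f : X -> Y) := forall y, exists x, f x = y.

Definition coring_morphism (k : comPzRingType) (A : algType k) (C D : coring A)
    (f : C -> D) :=
  [/\ linear f, rlinear f, forall x, comul (f x) = tmap f f (comul x) &
      forall x, counit (f x) = counit x].

Definition left_flat (R : pzRingType) (N : lmodType R) :=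
  forall (M M' : rmodType R) (f : M -> M'), rlinear f -> injective f ->
  injective (tmap f (@idfun N)).

Definition finitely_generated (R : pzRingType) (M : rmodType R) :=
  exists (n : nat) (e : 'I_n -> M), forall m, exists a : 'I_n -> R,
  m = \sum_i e i :* a i.

Definition projective (R : pzRingType) (M : rmodType R) :=
  forall (N P : rmodType R) (g : N -> P) (f : M -> P),
  rlinear g -> surjection g -> rlinear f ->
  exists2 h : M -> N, rlinear h & forall m, g (h m) = f m.

Definition division_ring (R : pzRingType) :=
  1 != 0 :> R /\ forall x : R, x != 0 -> exists y, x * y = 1 /\ y * x = 1.

Section ComoduleCategory.
Variables (k : comPzRingType) (A : algType k) (C : coring A).

Definition monomorphism (N M : comodule C) (f : colin N M) :=
  forall (P : comodule C) (g h : colin P N),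
  colin_comp f g = colin_comp f h -> g = h.

Definition isomorphism (N M : comodule C) (f : colin N M) :=
  exists g : colin M N, colin_comp f g = colin_id M /\ colin_comp g f = colin_id N.

Definition simple_comodule (M : comodule C) :=
  (exists m : M, m != 0) /\
  forall (N : comodule C) (f : colin N M), monomorphism f -> f = 0 \/ isomorphism f.

Definition galois (M : comodule C) :=
  [/\ finitely_generated M, projective M & isomorphism (evaluation M (regular_comodule C))].

End ComoduleCategory.

(* The right module R^n *)
Definition free_rmod (R : pzRingType) (n : nat) : Type := {ffun 'I_n -> R}.

Section FreeRmodule.
Variables (R : pzRingType) (n : nat).

HB.instance Definition _ := GRing.Zmodule.on (free_rmod R n).

Definition free_ract (x : free_rmod R n) (a : R) : free_rmod R n := [ffun i => x i * a].

Lemma free_ractA x a b : free_ract (free_ract x a) b = free_ract x (a * b).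
Proof. by apply/ffunP => i; rewrite !ffunE mulrA. Qed.
Lemma free_ract1 x : free_ract x 1 = x.
Proof. by apply/ffunP => i; rewrite !ffunE mulr1. Qed.
Lemma free_ractDl a : {morph free_ract^~ a : x y / x + y}.
Proof. by move=> x y; apply/ffunP => i; rewrite !ffunE mulrDl. Qed.
Lemma free_ractDr x : {morph free_ract x : a b / a + b}.
Proof. by move=> a b; apply/ffunP => i; rewrite !ffunE mulrDr. Qed.
HB.instance Definition _ := Zmodule_isRmodule.Build R (free_rmod R n)
  free_ractA free_ract1 free_ractDl free_ractDr.

End FreeRmodule.

(* Statements about all dual bases of such a module are not vacuous. *)
Lemma dual_basis_exists (R : pzRingType) (M : rmodType R) :
  finitely_generated M -> projective M ->
  exists (n : nat) (e : 'I_n -> M) (xi : 'I_n -> dual M), dual_basis e xi.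
Proof.
move=> [n [e e_gen]] M_proj; exists n, e.
pose g (x : free_rmod R n) : M := \sum_i e i :* x i.
have gl : rlinear g.
  split=> [x y|x a]; first by rewrite -big_split; apply: eq_bigr => i _; rewrite ffunE ractDr.
  by rewrite (morph_sum (ractDl a)); apply: eq_bigr => i _; rewrite ffunE ractA.
have g_surj : surjection g.
  move=> m; have [a ->] := e_gen m; exists [ffun i => a i].
  by apply: eq_bigr => i _; rewrite ffunE.
have [h [hD hr] gh] := M_proj _ _ g idfun gl g_surj (@rlinear_id _ M).
have xiD i : {morph (fun m => h m i) : x y / x + y}.
  by move=> x y; rewrite hD ffunE.
have xir i m a : h (m :* a) i = h m i * a by rewrite hr ffunE.
exists (fun i => Dual (xiD i) (xir i)) => m.
by rewrite -[LHS]gh.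
Qed.

(* Main.v *)
Require Import Defs.
From HB Require Import structures.
From mathcomp Require Import all_boot ssralg ssrint.
From mathcomp Require Import ring_quotient generic_quotient.
From mathcomp Require Import boolp classical_sets.

Set Implicit Arguments.
Unset Strict Implicit.
Unset Printing Implicit Defensive.

Import GRing.Theory.
Local Open Scope ring_scope.

(** Flatness of C makes kernels of colinear maps subcomodules (colin_kernel).
    Hence monomorphisms are injective, and a colinear map out of a simple comodule
    is zero or injective (simple_colin); sums of images of colinear maps have
    quotient comodules (colin_span_quotient).

    Let M be simple. A finite sum of images of M behaves like a semisimple object.
    Induction on the number of terms, dividing by the image of one of the maps at
    each step, shows two things. The evaluation map Hom(M, X) ⊗ M -> X is injective
    for every X (simple_evaluation_inj): whenever an image is contained in the sum
    of others, the map is a combination of the others with coefficients in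
    S = End(M), and this relation is available in the tensor product. Moreover a
    subcomodule of a comodule generated by M is generated by M (simple_trace_sub).
    Since N embeds into the cofree comodule N ⊗ C, which is generated by M as soon
    as C is, surjectivity at C implies surjectivity at every N
    (simple_evaluation_surj). As a bijective colinear map is an isomorphism, M,
    if finitely generated and projective, is Galois exactly when the evaluation
    map at C is onto. Finally, xi |-> (xi ⊗ C) rho, where rho is the coaction of M, identifies the dual of M with Hom(M, C), with
    inverse f |-> counit o f; under this identification the canonical map is the
    evaluation map at C (can_map_surj), and it is always a coring morphism.

    In the other direction, let M be Galois with S a division ring, and let
    f : N -> M be a nonzero monomorphism, with x = f n0 nonzero. An S-linear form lam on M with
    lam x = 1 induces, through the isomorphism of C with Hom(M, C) ⊗ M, left
    A-linear forms on C. Applying these to the coaction of n0 produces preimages under f of all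
    elements of M (galois_division_surj). So f is bijective and M is simple. *)

(** * Additive maps *)

Section Additive.
Variables (V W : zmodType) (f : V -> W).
Hypothesis fD : {morph f : x y / x + y}.

Lemma morphD0 : f 0 = 0.
Proof. by apply: (addIr (f 0)); rewrite -fD !add0r. Qed.

Lemma morphDN : {morph f : x / - x}.
Proof. by move=> x; apply: (addIr (f x)); rewrite -fD !addNr morphD0. Qed.

Lemma morphDB : {morph f : x y / x - y}.
Proof. by move=> x y; rewrite fD morphDN. Qed.

Lemma morphD_inj : (forall x, f x = 0 -> x = 0) -> injective f.
Proof.
by move=> f0 x y fxy; apply/eqP; rewrite -subr_eq0 [x - y]f0 // morphDB fxy subrr.
Qed.

End Additive.

Lemma surjection_section (X Y : Type) (f : X -> Y) :
  surjection f -> exists g, forall y, f (g y) = y.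
Proof. by move=> /choice[g gK]; exists g. Qed.

(** * Submodules and quotient modules *)

(** Membership is a proposition, as images and spans are not decidable. *)
Record submodule (R : pzRingType) (M : rmodType R) := Submodule {
  smem :> M -> Prop;
  smem0 : smem 0;
  smemB : forall x y, smem x -> smem y -> smem (x - y);
  smem_ract : forall x a, smem x -> smem (x :* a) }.

Section SubQuotient.
Variables (R : pzRingType) (M : rmodType R) (U : submodule M).

Definition smem_pred : {pred M} := fun x => `[< U x >].

Lemma smem_predP x : reflect (U x) (x \in smem_pred).
Proof. exact: asboolP. Qed.

Lemma smem_pred_closed : zmod_closed smem_pred.
Proof.
split=> [|x y /smem_predP xU /smem_predP yU]; apply/smem_predP.
  exact: smem0.
exact: smemB.
Qed.

HB.instance Definition _ := GRing.isZmodClosed.Build M smem_pred smem_pred_closed.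

Record sub_rmod := SubRmod { sub_val :> M; _ : sub_val \in smem_pred }.
HB.instance Definition _ := [isSub for sub_val].
HB.instance Definition _ := [Choice of sub_rmod by <:].
HB.instance Definition _ := [SubChoice_isSubZmodule of sub_rmod by <:].

Lemma sub_valP (u : sub_rmod) : U u.
Proof. by case: u => x /= /smem_predP. Qed.

Lemma sub_ract_subproof (u : sub_rmod) (a : R) : (u : M) :* a \in smem_pred.
Proof. exact/smem_predP/smem_ract/sub_valP. Qed.

Definition sub_ract (u : sub_rmod) (a : R) : sub_rmod := SubRmod (sub_ract_subproof u a).

Lemma sub_ractA u a b : sub_ract (sub_ract u a) b = sub_ract u (a * b).
Proof. by apply: val_inj; rewrite /= ractA. Qed.
Lemma sub_ract1 u : sub_ract u 1 = u.
Proof. by apply: val_inj; rewrite /= ract1. Qed.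
Lemma sub_ractDl a : {morph sub_ract^~ a : u v / u + v}.
Proof. by move=> u v; apply: val_inj; rewrite /= ractDl. Qed.
Lemma sub_ractDr u : {morph sub_ract u : a b / a + b}.
Proof. by move=> a b; apply: val_inj; rewrite /= ractDr. Qed.
HB.instance Definition _ := Zmodule_isRmodule.Build R sub_rmod
  sub_ractA sub_ract1 sub_ractDl sub_ractDr.

Lemma sub_val_rlinear : rlinear sub_val.
Proof. by []. Qed.

Lemma sub_val_inj : injective sub_val.
Proof. exact: val_inj. Qed.

Lemma sub_valS x : U x -> exists u : sub_rmod, sub_val u = x.
Proof. by move=> /smem_predP xU; exists (SubRmod xU). Qed.

Definition quo_rmod : Type := Quotient.quot smem_pred.
HB.instance Definition _ := GRing.Zmodule.on quo_rmod.

Definition quo_proj (x : M) : quo_rmod := \pi_(Quotient.quot smem_pred)%qT x.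

Lemma quo_projD : {morph quo_proj : x y / x + y}.
Proof. by move=> x y; rewrite /quo_proj; exact: raddfD. Qed.

Lemma quo_proj_eq0 x : quo_proj x = 0 <-> U x.
Proof.
rewrite -(morphD0 quo_projD).
split=> [/eqP|xU].
  by rewrite -Quotient.idealrBE subr0 => /smem_predP.
by apply/eqP; rewrite -Quotient.idealrBE subr0; apply/smem_predP.
Qed.

Lemma quo_proj_surj : surjection quo_proj.
Proof. by move=> q; exists (repr q); rewrite /quo_proj reprK. Qed.

Definition quo_ract (q : quo_rmod) (a : R) : quo_rmod := quo_proj (repr q :* a).

Lemma quo_proj_ract x a : quo_ract (quo_proj x) a = quo_proj (x :* a).
Proof.
apply/eqP; rewrite -subr_eq0 -(morphDB quo_projD); apply/eqP/quo_proj_eq0.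
rewrite -(morphDB (ractDl a)); apply: smem_ract; apply/quo_proj_eq0.
by rewrite (morphDB quo_projD) /quo_proj reprK subrr.
Qed.

Lemma quo_ractA q a b : quo_ract (quo_ract q a) b = quo_ract q (a * b).
Proof. by have [x <-] := quo_proj_surj q; rewrite !quo_proj_ract ractA. Qed.
Lemma quo_ract1 q : quo_ract q 1 = q.
Proof. by have [x <-] := quo_proj_surj q; rewrite quo_proj_ract ract1. Qed.
Lemma quo_ractDl a : {morph quo_ract^~ a : q r / q + r}.
Proof.
move=> q r; have [x <-] := quo_proj_surj q; have [y <-] := quo_proj_surj r.
by rewrite -quo_projD !quo_proj_ract ractDl quo_projD.
Qed.
Lemma quo_ractDr q : {morph quo_ract q : a b / a + b}.
Proof.
by move=> a b; have [x <-] := quo_proj_surj q; rewrite !quo_proj_ract ractDr quo_projD.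
Qed.
HB.instance Definition _ := Zmodule_isRmodule.Build R quo_rmod
  quo_ractA quo_ract1 quo_ractDl quo_ractDr.

Lemma quo_proj_rlinear : rlinear quo_proj.
Proof. by split=> [|x a]; [exact: quo_projD|rewrite -quo_proj_ract]. Qed.

End SubQuotient.

Section KernelImage.
Variables (R : pzRingType) (M N : rmodType R) (f : M -> N).
Hypothesis fl : rlinear f.

Lemma rlinear_ker_subproof :
  [/\ f 0 = 0, forall x y, f x = 0 -> f y = 0 -> f (x - y) = 0 &
      forall x a, f x = 0 -> f (x :* a) = 0].
Proof.
have [fD fA] := fl; split=> [|x y fx fy|x a fx]; first exact: morphD0.
  by rewrite (morphDB fD) fx fy subrr.
by rewrite fA fx (morphD0 (ractDl a)).
Qed.

Definition rker : submodule M :=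
  let: And3 k0 kB kA := rlinear_ker_subproof in
  @Submodule _ _ (fun x => f x = 0) k0 kB kA.

Lemma rimg_subproof :
  [/\ exists x, f x = 0,
      forall y z, (exists x, f x = y) -> (exists x, f x = z) -> exists x, f x = y - z &
      forall y a, (exists x, f x = y) -> exists x, f x = y :* a].
Proof.
have [fD fA] := fl; split=> [|_ _ [x <-] [y <-]|_ a [x <-]].
- by exists 0; exact: morphD0.
- by exists (x - y); exact: morphDB.
- by exists (x :* a).
Qed.

Definition rimg : submodule N :=
  let: And3 i0 iB iA := rimg_subproof in
  @Submodule _ _ (fun y => exists x, f x = y) i0 iB iA.

Lemma rkerE x : rker x <-> f x = 0.
Proof. by rewrite /rker; case: rlinear_ker_subproof. Qed.

Lemma rimgE y : rimg y <-> exists x, f x = y.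
Proof. by rewrite /rimg; case: rimg_subproof. Qed.

End KernelImage.

(** * Right exactness of the tensor product *)

(** Right exactness at the middle term. Since p is onto, it has a set-theoretic
    section s, and sending q ⊗ n to the class of s q ⊗ n modulo the image of
    j ⊗ N is well defined because two sections differ by elements of the image
    of j. This map undoes p ⊗ N modulo the image of j ⊗ N. *)
Lemma tmap_ker (R T : pzRingType) (K M Q : rmodType R) (N : bimodType R T)
    (j : K -> M) (p : M -> Q) : rlinear j -> rlinear p -> surjection p ->
  (forall u, p (j u) = 0) -> (forall m, p m = 0 -> exists u, j u = m) ->
  forall t : tensor M N, tmap p idfun t = 0 -> exists s : tensor K N, tmap j idfun s = t.
Proof.
move=> jl pl p_surj pj ker_p t pt0.
have idl := @linear_id _ N; have idr := @rlinear_id _ N.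
pose W := rimg (tmap_rlinear jl idl idr).
have [s sK] := surjection_section p_surj.
have p0 : p 0 = 0 := morphD0 pl.1.
have lift_p m m' n : p m = p m' -> quo_proj W (m ⊗ n) = quo_proj W (m' ⊗ n).
  move=> pmm'; apply/eqP; rewrite -subr_eq0 -(morphDB (@quo_projD _ _ W)).
  apply/eqP/quo_proj_eq0/rimgE.
  have [|u ju] := ker_p (m - m'); first by rewrite (morphDB pl.1) pmm' subrr.
  by exists (u ⊗ n); rewrite tmapE // ju tensDl tensNl.
have bal : balanced (fun q n => quo_proj W (s q ⊗ n)).
  split=> [n q q'|q n n'|q a n].
  - rewrite -quo_projD -tensDl; apply: lift_p; by rewrite pl.1 !sK.
  - by rewrite -quo_projD tensDr.
  - by rewrite -tensA; apply: lift_p; rewrite pl.2 !sK.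
have E u : tlift (fun q n => quo_proj W (s q ⊗ n)) (tmap p idfun u) = quo_proj W u.
  elim/tensor_ind: u => [m n|u v IHu IHv].
    by rewrite tmapE // (tliftE bal); apply: lift_p; rewrite sK.
  by rewrite tmapD // (tliftD bal) IHu IHv quo_projD.
have /quo_proj_eq0/rimgE // : quo_proj W t = 0.
by rewrite -E pt0 (morphD0 (tliftD bal)).
Qed.

Lemma tmap_eq0 (R : pzRingType) (M M' : rmodType R) (N N' : lmodType R)
    (f : M -> M') (g : N -> N') : rlinear f -> linear g ->
  (forall m, f m = 0) -> forall t, tmap f g t = 0.
Proof.
move=> fl gl f0; elim/tensor_ind => [m n|s t IHs IHt]; first by rewrite tmapE // f0 tens0l.
by rewrite tmapD // IHs IHt addr0.
Qed.

Lemma tassoc_natl (R T : pzRingType) (M M' : rmodType R) (N : bimodType R T)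
    (P : lmodType T) (f : M -> M') : rlinear f ->
  forall t : tensor [the rmodType T of tensor M N] P,
  tmap f idfun (tassoc t) = tassoc (tmap (tmap f idfun) idfun t).
Proof.
move=> fl t; rewrite (tassoc_nat fl (@linear_id _ N) (@rlinear_id _ N) (@linear_id _ P)).
by apply: eq_tmap => // d; rewrite /= tmap_id.
Qed.

Section TensorAssocInverse.
Variables (R T : pzRingType) (M : rmodType R) (N : bimodType R T) (P : lmodType T).

Lemma tens_rlinear (m : M) : rlinear (fun n : N => m ⊗ n).
Proof. by split=> [x y|n a]; [exact: tensDr|rewrite tens_ract]. Qed.

Definition tassocV : tensor M [the lmodType R of tensor N P] ->
    tensor [the rmodType T of tensor M N] P :=
  tlift (fun m t => tmap (fun n : N => m ⊗ n) (@idfun P) t).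

Lemma tassocV_balanced :
  balanced (fun (m : M) (t : tensor N P) => tmap (fun n : N => m ⊗ n) (@idfun P) t).
Proof.
have ml := tens_rlinear; have idl := @linear_id _ P.
split=> [t m m'|m t t'|m a t]; last 2 first.
- exact: tmapD.
- have al := @rlinear_scale _ _ N a; rewrite [a *: t]/(GRing.scale _ _) /= /tscale.
  rewrite (tmap_comp (ml m) idl al idl); apply: eq_tmap => // n /=.
  by rewrite tensA.
elim/tensor_ind: t => [n p|s t IHs IHt]; first by rewrite !tmapE // !tensDl.
by rewrite !tmapD // IHs IHt addrACA.
Qed.

Lemma tassocVE m n p : tassocV (m ⊗ (n ⊗ p)) = (m ⊗ n) ⊗ p.
Proof. by rewrite /tassocV (tliftE tassocV_balanced) tmapE //; exact: tens_rlinear. Qed.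

Lemma tassocVD : {morph tassocV : x y / x + y}.
Proof. exact: (tliftD tassocV_balanced). Qed.

Lemma tassocK : cancel (@tassoc R T M N P) tassocV.
Proof.
apply: tensor3_ext => [x y|//|m n p]; first by rewrite tassocD tassocVD.
by rewrite tassocE tassocVE.
Qed.

Lemma tassocVK : cancel tassocV (@tassoc R T M N P).
Proof.
apply: tensor_ext => [x y|//|m t]; first by rewrite tassocVD tassocD.
elim/tensor_ind: t => [n p|s t IHs IHt]; first by rewrite tassocVE tassocE.
by rewrite tensDr tassocVD tassocD IHs IHt.
Qed.

End TensorAssocInverse.

(** * Kernels and cokernels of colinear maps *)

Section KernelsCokernels.
Variables (k : comPzRingType) (A : algType k) (C : coring A).

Let lC : linear (@idfun C). Proof. exact: linear_id. Qed.

Lemma counit_lift_nat (M N : rmodType A) (f : M -> N) : rlinear f ->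
  forall t : tensor M C, f (tlift (fun m c => m :* counit c) t) =
                         tlift (fun m c => m :* counit c) (tmap f idfun t).
Proof.
move=> fl; have bM := @counit_balanced k A C M; have bN := @counit_balanced k A C N.
elim/tensor_ind => [m c|s t IHs IHt].
  by rewrite tmapE // (tliftE bM) (tliftE bN) fl.2.
by rewrite tmapD // (tliftD bM) (tliftD bN) fl.1 IHs IHt.
Qed.

(** The coaction of X restricts to a map U -> U ⊗ C, uniquely as U ⊗ C embeds
    into X ⊗ C. Coassociativity may be tested in X ⊗ (C ⊗ C), and U ⊗ (C ⊗ C)
    embeds there by applying flatness of C twice. *)
Lemma sub_comodule (C_flat : left_flat C) (X : comodule C) (U : submodule X) :
  (forall u : sub_rmod U, exists t, tmap (@sub_val _ _ U) (@idfun C) t = coact (u : X)) ->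
  exists (K : comodule C) (j : colin K X),
    injective j /\ forall x, U x <-> exists u, j u = x.
Proof.
move=> /choice[rho rhoE]; set i := @sub_val _ _ U in rhoE.
have il : rlinear i := @sub_val_rlinear _ _ U.
have iC_inj : injective (tmap i (@idfun C)) by apply: C_flat => //; exact: sub_val_inj.
have iCl : rlinear (tmap i (@idfun C)) by apply: tmap_rlinear.
have rhoD : {morph rho : x y / x + y}.
  by move=> x y; apply: iC_inj; rewrite tmapD // !rhoE coactD.
have rhoA x a : rho (x :* a) = rho x :* a.
  by apply: iC_inj; rewrite iCl.2 !rhoE coact_ract.
have rhol : rlinear rho by [].
have coassoc u : tassoc (tmap rho idfun (rho u)) = tmap idfun (@comul _ _ C) (rho u).
  have iCC_inj : injective (tmap i (@idfun (tensor C C))).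
    have iiC_inj : injective (tmap (tmap i (@idfun C)) (@idfun C)) by apply: C_flat.
    move=> s t; rewrite -(tassocVK s) -(tassocVK t) !(tassoc_natl il).
    by move=> /(can_inj (@tassocK _ _ _ _ _)) /iiC_inj ->.
  have [cX lD] := (coact_rlinear X, @comul_linear k A C).
  apply: iCC_inj; rewrite (tassoc_natl il) (tmap_comp iCl lC rhol lC).
  rewrite (@eq_tmap _ _ _ _ _ _ (coact (c := X) \o i) _ (idfun \o idfun)) //.
  rewrite -(tmap_comp cX lC il lC) rhoE coactA -rhoE.
  rewrite (tmap_comp (@rlinear_id _ X) lD il lC).
  by rewrite (tmap_comp il (@linear_id _ (tensor C C)) (@rlinear_id _ _) lD).
have counitr u : tlift (fun m c => m :* counit c) (rho u) = u.
  by apply: sub_val_inj; rewrite -[LHS]/(i _) (counit_lift_nat il) rhoE coact_counit.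
pose K := Comodule rhoD rhoA coassoc counitr.
have jE u : coact (i u) = tmap i idfun (rho u) by rewrite rhoE.
exists K, (@Colin _ _ _ K X i il jE); split=> [|x]; first exact: sub_val_inj.
split=> [|[u <-]]; last exact: sub_valP.
exact: sub_valS.
Qed.

(** The hypothesis says that the coaction of X passes to the quotient. The axioms
    then descend along the projection. *)
Lemma quotient_comodule (X : comodule C) (U : submodule X) :
  (forall u, U u -> tmap (@quo_proj _ _ U) (@idfun C) (coact u) = 0) ->
  exists (Q : comodule C) (p : colin X Q), surjection p /\ forall x, p x = 0 <-> U x.
Proof.
move=> U_st; pose p := @quo_proj _ _ U.
have pl : rlinear p := @quo_proj_rlinear _ _ U.
have pCl : rlinear (tmap p (@idfun C)) by apply: tmap_rlinear.
have [s sK] : exists s, forall q, p (s q) = q.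
  exact: surjection_section (@quo_proj_surj _ _ U).
pose rho q := tmap p (@idfun C) (coact (s q)).
have rhoE x : rho (p x) = tmap p idfun (coact x).
  have cl := coact_rlinear X.
  apply/eqP; rewrite -subr_eq0 -(morphDB pCl.1) -(morphDB cl.1); apply/eqP/U_st.
  by apply/quo_proj_eq0; rewrite -[LHS]/(p _) (morphDB pl.1) sK subrr.
have rhoD : {morph rho : x y / x + y}.
  move=> q r; have [x <-] := quo_proj_surj q; have [y <-] := quo_proj_surj r.
  by rewrite -quo_projD !rhoE coactD pCl.1.
have rhoA q a : rho (q :* a) = rho q :* a.
  have [x <-] := quo_proj_surj q.
  by rewrite -(quo_proj_rlinear U).2 !rhoE coact_ract pCl.2.
have coassoc q : tassoc (tmap rho idfun (rho q)) = tmap idfun (@comul _ _ C) (rho q).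
  have [x <-] := quo_proj_surj q.
  exact: (coassoc_transport (@comul_linear k A C) (@comul_rlinear k A C)
    (coact_rlinear X) (conj rhoD rhoA) pl rhoE (coactA x)).
have counitr q : tlift (fun m c => m :* counit c) (rho q) = q.
  by have [x <-] := quo_proj_surj q; rewrite rhoE -(counit_lift_nat pl) coact_counit.
pose Q := Comodule rhoD rhoA coassoc counitr.
exists Q, (@Colin _ _ _ X Q p pl rhoE); split; first exact: quo_proj_surj.
exact: quo_proj_eq0.
Qed.

End KernelsCokernels.

Section Colinear.
Variables (k : comPzRingType) (A : algType k) (C : coring A).

Let lC : linear (@idfun C). Proof. exact: linear_id. Qed.

Lemma colin0 (X Y : comodule C) (f : colin X Y) : f 0 = 0.
Proof. exact: (morphD0 (colinD f)). Qed.

Lemma colinB (X Y : comodule C) (f : colin X Y) : {morph f : x y / x - y}.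
Proof. exact: (morphDB (colinD f)). Qed.

Lemma bijective_isomorphism (X Y : comodule C) (f : colin X Y) :
  injective f -> surjection f -> isomorphism f.
Proof.
move=> f_inj /surjection_section[g gK]; have fl := colin_rlinear f.
have fK x : g (f x) = x by apply: f_inj; rewrite gK.
have gl : rlinear g.
  by split=> [x y|x a]; apply: f_inj; rewrite gK ?fl.1 ?fl.2 !gK.
have gC y : coact (g y) = tmap g idfun (coact y).
  rewrite -{2}(gK y) colin_coact (tmap_comp gl lC fl lC).
  by rewrite (@eq_tmap _ _ _ _ _ _ idfun _ idfun) ?tmap_id // => x; exact: fK.
by exists (Colin gl gC); split; apply: colin_eq.
Qed.

Lemma isomorphism_surj (X Y : comodule C) (f : colin X Y) :
  isomorphism f -> surjection f.
Proof. by move=> [g [fg _]] y; exists (g y); rewrite -[RHS]/(colin_id Y y) -fg. Qed.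

Lemma coact_inj (X : comodule C) : injective (@coact _ _ C X).
Proof. by move=> x y xy; rewrite -(coact_counit x) xy coact_counit. Qed.

Hypothesis C_flat : left_flat C.

(** Flatness makes the kernel of f a subcomodule: factor f as a surjection p
    onto its image followed by an injection j. As j ⊗ C is injective, the coaction
    of an element of the kernel is killed by p ⊗ C, hence comes from U ⊗ C by
    right exactness. *)
Lemma colin_kernel (X Y : comodule C) (f : colin X Y) :
  exists (K : comodule C) (j : colin K X),
    injective j /\ forall x, f x = 0 <-> exists u, j u = x.
Proof.
have fl := colin_rlinear f.
pose U := rker fl; pose i := @sub_val _ _ U; have il : rlinear i := @sub_val_rlinear _ _ U.
pose I := rimg fl; pose j := @sub_val _ _ I; have jl : rlinear j := @sub_val_rlinear _ _ I.
have j_inj : injective j by exact: sub_val_inj.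
have jC_inj : injective (tmap j (@idfun C)) by apply: C_flat.
have /choice[p pE] : forall x, exists y, j y = f x.
  by move=> x; apply: sub_valS; apply/rimgE; exists x.
have pl : rlinear p.
  by split=> [x y|x a]; apply: j_inj; rewrite ?jl.1 ?jl.2 !pE ?fl.1 ?fl.2.
have ker_i x : p x = 0 <-> U x.
  split=> [px0|/rkerE fx0]; first by apply/rkerE; rewrite -pE px0.
  by apply: j_inj; rewrite pE fx0.
have [u|K [j' [j'_inj j'E]]] := @sub_comodule _ _ _ C_flat X U; last first.
  by exists K, j'; split=> // x; rewrite -j'E; split=> [? |/rkerE //]; apply/rkerE.
apply: (tmap_ker il pl) => [y|v|x /ker_i xU|].
- have [x fx] : exists x, f x = j y by apply/(rimgE fl)/sub_valP.
  by exists x; apply: j_inj; rewrite pE.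
- by apply/ker_i; exact: sub_valP.
- exact: sub_valS.
apply: jC_inj; rewrite (morphD0 (tmapD jl lC)) (tmap_comp jl lC pl lC).
rewrite (@eq_tmap _ _ _ _ _ _ f _ idfun) // -colin_coact.
by rewrite [f _](_ : _ = 0) ?coact0 //; apply/(rkerE fl)/sub_valP.
Qed.

(** The inclusion of the kernel and the zero map have the same composite with f. *)
Lemma monomorphism_inj (X Y : comodule C) (f : colin X Y) : monomorphism f -> injective f.
Proof.
move=> f_mono; apply: (morphD_inj (colinD f)) => x fx0.
have [K [j [_ jE]]] := colin_kernel f; have [/(_ fx0) [u <-] _] := jE x.
have -> // : j = 0.
apply: f_mono; apply: colin_eq => v /=.
by rewrite colin0; apply/jE; exists v.
Qed.

Lemma inj_monomorphism (X Y : comodule C) (f : colin X Y) : injective f -> monomorphism f.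
Proof.
move=> f_inj P g h fgh; apply: colin_eq => x; apply: f_inj.
by rewrite -[LHS]/(colin_comp f g x) fgh.
Qed.

(** The corestriction is automatically colinear, as this may be tested after
    applying the injective map i ⊗ C. *)
Lemma colin_factor (X Y Z : comodule C) (i : colin Y Z) (f : colin X Z) :
  injective i -> (forall x, exists y, i y = f x) ->
  exists g : colin X Y, colin_comp i g = f.
Proof.
move=> i_inj /choice[g gE]; have [il fl] := (colin_rlinear i, colin_rlinear f).
have iC_inj : injective (tmap i (@idfun C)) by apply: C_flat.
have gl : rlinear g.
  by split=> [x y|x a]; apply: i_inj; rewrite ?il.1 ?il.2 !gE ?fl.1 ?fl.2.
have gC x : coact (g x) = tmap g idfun (coact x).
  apply: iC_inj; rewrite -colin_coact gE colin_coact (tmap_comp il lC gl lC).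
  by apply: eq_tmap => // y; rewrite /= gE.
by exists (Colin gl gC); apply: colin_eq.
Qed.

End Colinear.

(** * Comodules generated by a simple comodule *)

Lemma tensor_sum (R : pzRingType) (M : rmodType R) (N : lmodType R) (t : tensor M N) :
  exists (r : nat) (x : 'I_r -> M) (y : 'I_r -> N), t = \sum_i x i ⊗ y i.
Proof.
suff [s ->] : exists s : seq (M * N), t = \sum_(p <- s) p.1 ⊗ p.2.
  exists (size s), (fun i => (tnth (in_tuple s) i).1), (fun i => (tnth (in_tuple s) i).2).
  by rewrite big_tnth.
elim/tensor_ind: t => [m n|_ _ [s ->] [s' ->]]; first by exists [:: (m, n)]; rewrite big_seq1.
by exists (s ++ s'); rewrite big_cat.
Qed.

Section ColinearSpan.
Variables (k : comPzRingType) (A : algType k) (C : coring A).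
Variables (M X : comodule C) (r : nat) (g : 'I_r -> colin M X).

Lemma colin_span_subproof :
  [/\ exists m : 'I_r -> M, 0 = \sum_i g i (m i),
      forall x y, (exists m : 'I_r -> M, x = \sum_i g i (m i)) ->
        (exists m : 'I_r -> M, y = \sum_i g i (m i)) ->
        exists m : 'I_r -> M, x - y = \sum_i g i (m i) &
      forall x a, (exists m : 'I_r -> M, x = \sum_i g i (m i)) ->
        exists m : 'I_r -> M, x :* a = \sum_i g i (m i)].
Proof.
split=> [|_ _ [m ->] [m' ->]|_ a [m ->]].
- by exists (fun=> 0); rewrite big1 // => i _; rewrite colin0.
- by exists (fun i => m i - m' i); rewrite -sumrB; apply: eq_bigr => i _; rewrite colinB.
- exists (fun i => m i :* a); rewrite ract_suml.
  by apply: eq_bigr => i _; rewrite colin_ract.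
Qed.

Definition colin_span : submodule X :=
  let: And3 s0 sB sA := colin_span_subproof in
  @Submodule _ _ (fun x => exists m : 'I_r -> M, x = \sum_i g i (m i)) s0 sB sA.

Lemma colin_spanE x : colin_span x <-> exists m : 'I_r -> M, x = \sum_i g i (m i).
Proof. by rewrite /colin_span; case: colin_span_subproof. Qed.

(** A sum of images of colinear maps is stable under the coaction, so dividing
    by it stays inside the category of comodules. *)
Lemma colin_span_quotient : exists (Q : comodule C) (p : colin X Q),
  forall x, p x = 0 <-> exists m : 'I_r -> M, x = \sum_i g i (m i).
Proof.
have pl := quo_proj_rlinear colin_span; have lC := @linear_id _ C.
have [x /colin_spanE[m ->]|Q [p [_ pE]]] := @quotient_comodule _ _ _ X colin_span.
  rewrite (morph_sum (@coactD _ _ _ X)) (morph_sum (tmapD pl lC)) big1 // => i _.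
  have gl := colin_rlinear (g i); rewrite colin_coact (tmap_comp pl lC gl lC).
  apply: tmap_eq0 => //; first exact: rlinear_comp.
  move=> n; apply/quo_proj_eq0/colin_spanE; exists (fun j => if j == i then n else 0).
  rewrite (bigD1 i) //= eqxx big1 ?addr0 // => j /negPf ->.
  by rewrite colin0.
by exists Q, p => x; rewrite pE colin_spanE.
Qed.

End ColinearSpan.

Section SimpleComodule.
Variables (k : comPzRingType) (A : algType k) (C : coring A).
Hypothesis C_flat : left_flat C.

Lemma colin_image_quotient (M X : comodule C) (f : colin M X) :
  exists (Q : comodule C) (p : colin X Q), forall x, p x = 0 <-> exists m, x = f m.
Proof.
have [Q [p pE]] := colin_span_quotient (fun _ : 'I_1 => f).
exists Q, p => x; rewrite pE; split=> [[m ->]|[m ->]].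
  by rewrite big_ord1; exists (m ord0).
by exists (fun=> m); rewrite big_ord1.
Qed.

Lemma colin_sumE (M X : comodule C) (r : nat) (f : 'I_r -> colin M X) m :
  (\sum_i f i) m = \sum_i f i m.
Proof. exact: (big_morph (fun h : colin M X => h m)). Qed.

Variable M : comodule C.
Hypothesis M_simple : simple_comodule M.

(** The half of Schur's lemma that drives all dichotomies below: the inclusion
    of the kernel of f is a monomorphism into M, so it is zero or onto. *)
Lemma simple_colin (X : comodule C) (f : colin M X) :
  (forall m, f m = 0) \/ injective f.
Proof.
have [K [j [j_inj jE]]] := colin_kernel C_flat f.
have [j0|j_iso] := M_simple.2 K j (inj_monomorphism j_inj); [right|left] => [|m].
  by apply: (morphD_inj (colinD f)) => m /jE[u <-]; rewrite j0.
by apply/jE; exact: isomorphism_surj.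
Qed.

(** Modulo the image of g_0 the induction
    hypothesis expresses f through the remaining g i; the error h takes values in
    the image of g_0, and g_0 is zero or injective, so h factors through g_0. *)
Lemma simple_colin_comb (X : comodule C) (r : nat) (g : 'I_r -> colin M X)
    (f : colin M X) :
  (forall m, exists n : 'I_r -> M, f m = \sum_i g i (n i)) ->
  exists s : 'I_r -> colin M M, f = \sum_i g i :* s i.
Proof.
elim: r => [|r IHr] in X g f *.
  move=> f0; exists (fun=> 0); apply: colin_eq => m.
  by have [n ->] := f0 m; rewrite !big_ord0.
move=> f_span; have [Q [p pE]] := colin_image_quotient (g ord0).
have p0 m : p (g ord0 m) = 0 by apply/pE; exists m.
have [m|s sE] := IHr Q (fun i => colin_comp p (g (lift ord0 i))) (colin_comp p f).
  have [n fm] := f_span m; exists (fun i => n (lift ord0 i)).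
  by rewrite /= fm big_ord_recl colinD p0 add0r (morph_sum (colinD p)).
pose h := f - \sum_i g (lift ord0 i) :* s i.
have h_img m : exists y, h m = g ord0 y.
  apply/pE; rewrite /h -[LHS]/(p (f m - (\sum_i g (lift ord0 i) :* s i) m)) colinB.
  rewrite -[p (f m)]/(colin_comp p f m) sE !colin_sumE (morph_sum (colinD p)).
  by rewrite subrr.
have [s0 s0E] : exists s0, h = g ord0 :* s0.
  have [g0|g_inj] := simple_colin (g ord0).
    by exists 0; apply: colin_eq => m; have [y ->] := h_img m; rewrite g0 [RHS]g0.
  have [m|s0 <-] := colin_factor C_flat (f := h) g_inj; last by exists s0.
  by have [y ->] := h_img m; exists y.
exists (fun i => if unlift ord0 i is Some j then s j else s0).
rewrite big_ord_recl unlift_none -s0E.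
by under eq_bigr do rewrite liftK; rewrite subrK.
Qed.

(** Relations among values of colinear maps already hold in the tensor product
    over End(M). The image of g_0 either meets the sum of the others trivially, in
    which case m_0 = 0, or lies inside it; then g_0 = sum of g_i s_i, and g_0 ⊗ m_0
    is absorbed into the other terms by balancedness. *)
Lemma simple_tens_eq0 (X : comodule C) (r : nat) (g : 'I_r -> colin M X)
    (m : 'I_r -> M) : \sum_i g i (m i) = 0 ->
  \sum_i g i ⊗ (m i : endmod M) = 0.
Proof.
elim: r => [|r IHr] in g m *; first by rewrite !big_ord0.
rewrite !big_ord_recl => gm0.
have [Q [p pE]] := colin_span_quotient (fun i => g (lift ord0 i)).
have [pg0|pg_inj] := simple_colin (colin_comp p (g ord0)); last first.
  have m0 : m ord0 = 0.
    apply: pg_inj; rewrite colin0; apply/pE; exists (fun i => - m (lift ord0 i)).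
    rewrite (eq_bigr _ (fun i _ => morphDN (colinD _) _)) sumrN.
    by apply/eqP; rewrite -addr_eq0 gm0.
  move: gm0; rewrite m0 tens0r colin0 !add0r; exact: IHr.
have [n|s sE] := simple_colin_comb (g := fun i => g (lift ord0 i)) (f := g ord0).
  by apply/pE; exact: pg0.
rewrite sE tens_suml -big_split /=.
under eq_bigr do rewrite tensA -tensDr.
apply: (IHr (fun i => g (lift ord0 i)) (fun i => s i (m ord0) + m (lift ord0 i))).
rewrite -[RHS]gm0 sE colin_sumE -big_split; apply: eq_bigr => i _.
by rewrite colinD.
Qed.

Lemma simple_evaluation_inj (X : comodule C) : injective (evaluation M X).
Proof.
apply: (morphD_inj (colinD (evaluation M X))) => t.
have [r [f [m ->]]] := tensor_sum t; rewrite (morph_sum (colinD _)) => fm0.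
apply: simple_tens_eq0; rewrite -[RHS]fm0; apply: eq_bigr => i _.
by rewrite /= evE.
Qed.

(** This yields that a subcomodule of a comodule generated by M is generated by M.
    If the image of f_0 lies in Y then f_0 m_0 can be subtracted from y; otherwise it
    meets Y trivially, and Y still embeds into X modulo that image, where one term
    of the sum has vanished. *)
Lemma simple_trace_sub (X Y : comodule C) (j : colin Y X) (r : nat)
    (f : 'I_r -> colin M X) (m : 'I_r -> M) (y : Y) :
  injective j -> j y = \sum_i f i (m i) -> exists t, evaluation M Y t = y.
Proof.
elim: r => [|r IHr] in X j f m y *; move=> j_inj.
  rewrite big_ord0 -(colin0 j) => /j_inj ->.
  by exists 0; rewrite colin0.
rewrite big_ord_recl => jy; have [Q [p pE]] := colin_image_quotient j.
have [pf0|pf_inj] := simple_colin (colin_comp p (f ord0)).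
  have [n|g gE] := colin_factor C_flat (f := f ord0) j_inj.
    by have [z ->] : exists z, f ord0 n = j z; [apply/pE; exact: pf0|exists z].
  have [|t tE] := IHr X j (fun i => f (lift ord0 i)) (fun i => m (lift ord0 i))
    (y - g (m ord0)) j_inj.
    by rewrite colinB -[j (g _)]/(colin_comp j g _) gE jy addrAC subrr add0r.
  exists (t + g ⊗ (m ord0 : endmod M)).
  by rewrite colinD tE /= evE subrK.
have [Q' [p' p'E]] := colin_image_quotient (f ord0).
apply: (IHr Q' (colin_comp p' j) (fun i => colin_comp p' (f (lift ord0 i)))
  (fun i => m (lift ord0 i))).
  apply: (morphD_inj (colinD _)) => z /p'E[n jz].
  have n0 : n = 0 by apply: pf_inj; rewrite colin0; apply/pE; exists z.
  by apply: j_inj; rewrite jz n0 !colin0.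
have p'f0 : p' (f ord0 (m ord0)) = 0 by apply/p'E; exists (m ord0).
by rewrite /= jy colinD p'f0 add0r (morph_sum (colinD _)).
Qed.

End SimpleComodule.

Section Cofree.
Variables (k : comPzRingType) (A : algType k) (C : coring A) (N : rmodType A).

Let lC : linear (@idfun C). Proof. exact: linear_id. Qed.
Let rN : rlinear (@idfun N). Proof. by []. Qed.
Let lD := @comul_linear k A C.

(** The cofree comodule N ⊗ C, whose coaction is N ⊗ Delta. Every comodule embeds
    into a cofree one by its coaction, and every n in N gives a colinear map
    C -> N ⊗ C; this is how properties of C spread to all comodules. *)
Definition cofree_coact (t : tensor N C) : tensor [the rmodType A of tensor N C] C :=
  tassocV (tmap idfun (@comul _ _ C) t).

Lemma cofree_coactD : {morph cofree_coact : x y / x + y}.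
Proof. by move=> x y; rewrite /cofree_coact tmapD // tassocVD. Qed.

Lemma cofree_coactE n c : cofree_coact (n ⊗ c) = tmap (fun d : C => n ⊗ d) idfun (comul c).
Proof. by rewrite /cofree_coact tmapE // /tassocV (tliftE (@tassocV_balanced _ _ _ _ _)). Qed.

Lemma cofree_coact_ract x a : cofree_coact (x :* a) = cofree_coact x :* a.
Proof.
elim/tensor_ind: x => [n c|u v IHu IHv].
  rewrite tens_ract !cofree_coactE comul_ract.
  by apply: (tmap_rlinear (tens_rlinear _ n) _ _).2.
by rewrite ractDl !cofree_coactD IHu IHv ractDl.
Qed.

Lemma cofree_coactA x :
  tassoc (tmap cofree_coact idfun (cofree_coact x)) =
  tmap idfun (@comul k A C) (cofree_coact x).
Proof.
have Hr : rlinear cofree_coact := conj cofree_coactD cofree_coact_ract.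
elim/tensor_ind: x => [n c|u v IHu IHv].
  exact: (coassoc_transport lD (@comul_rlinear k A C) (@comul_rlinear k A C) Hr
    (tens_rlinear C n) (cofree_coactE n) (comulA c)).
rewrite !cofree_coactD (tmapD Hr lC) tassocD (tmapD (@rlinear_id _ _) lD).
by rewrite IHu IHv.
Qed.

Lemma cofree_coact_counit x : tlift (fun y c => y :* counit c) (cofree_coact x) = x.
Proof.
elim/tensor_ind: x => [n c|u v IHu IHv]; last first.
  by rewrite cofree_coactD (tliftD (@counit_balanced k A C _)) IHu IHv.
by rewrite cofree_coactE -(counit_lift_nat (tens_rlinear C n)) comul_counitr.
Qed.

Definition cofree : comodule C :=
  Comodule cofree_coactD cofree_coact_ract cofree_coactA cofree_coact_counit.

Definition cofree_tens (n : N) : colin (regular_comodule C) cofree :=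
  @Colin _ _ _ (regular_comodule C) cofree _ (tens_rlinear C n) (cofree_coactE n).

End Cofree.

Section Coaction.
Variables (k : comPzRingType) (A : algType k) (C : coring A).

Lemma coact_colinear_subproof (N : comodule C) (n : N) :
  cofree_coact (coact n) = tmap (@coact _ _ C N) idfun (coact n).
Proof. by rewrite /cofree_coact -coactA tassocK. Qed.

Definition coact_colin (N : comodule C) : colin N (cofree C N) :=
  @Colin _ _ _ N (cofree C N) _ (coact_rlinear N) (@coact_colinear_subproof N).

Lemma evaluation_cofree_surj (M N : comodule C) :
  surjection (evaluation M (regular_comodule C)) -> surjection (evaluation M (cofree C N)).
Proof.
move=> evC_surj; elim/tensor_ind => [n c|_ _ [s <-] [t <-]]; last first.
  by exists (s + t); rewrite colinD.
have [u <-] := evC_surj c; elim/tensor_ind: u => [f m|s t [s' sE] [t' tE]].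
  by exists (colin_comp (cofree_tens C n) f ⊗ m); rewrite /= !evE.
by exists (s' + t'); rewrite colinD sE tE [in RHS]colinD tensDr.
Qed.

(** N embeds by its coaction into the cofree comodule N ⊗ C, which is generated by
    M because C is. *)
Lemma simple_evaluation_surj (C_flat : left_flat C) (M : comodule C) :
  simple_comodule M -> surjection (evaluation M (regular_comodule C)) ->
  forall N : comodule C, surjection (evaluation M N).
Proof.
move=> M_simple evC_surj N n.
have [t tE] := evaluation_cofree_surj (N := N) evC_surj (coact n).
have [r [f [m tsum]]] := tensor_sum t.
apply: (simple_trace_sub C_flat M_simple (j := coact_colin N) (f := f) (m := m)).
  exact: coact_inj.
rewrite -[LHS]tE tsum (morph_sum (colinD _)).
by apply: eq_bigr => i _; rewrite /= evE.
Qed.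

End Coaction.

(** * Linear forms and the canonical map *)

Section Contract.
Variables (R : pzRingType) (M : rmodType R).
Implicit Types xi : dual M.

(** The map xi ⊗ N, followed by the identification of R ⊗ N with N. *)
Definition contract (N : lmodType R) xi (t : tensor M N) : N :=
  tlift (fun m n => xi m *: n) t.

Lemma contract_balanced (N : lmodType R) xi : balanced (fun (m : M) (n : N) => xi m *: n).
Proof.
split=> [n m m'|m n n'|m a n]; first by rewrite dualD scalerDl.
  by rewrite scalerDr.
by rewrite dual_ract scalerA.
Qed.

Lemma contractE (N : lmodType R) xi m (n : N) : contract xi (m ⊗ n) = xi m *: n.
Proof. exact: (tliftE (contract_balanced N xi)). Qed.

Lemma contractD (N : lmodType R) xi : {morph @contract N xi : s t / s + t}.
Proof. exact: (tliftD (contract_balanced N xi)). Qed.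

Lemma contract_rlinear (T : pzRingType) (N : bimodType R T) xi : rlinear (@contract N xi).
Proof.
split=> [|t a]; first exact: contractD.
elim/tensor_ind: t => [m n|s t IHs IHt]; first by rewrite tens_ract !contractE scale_ract.
by rewrite ractDl !contractD IHs IHt ractDl.
Qed.

Lemma contract_dualD (N : lmodType R) (t : tensor M N) :
  {morph (fun xi => contract xi t) : xi zeta / xi + zeta}.
Proof.
move=> xi zeta; elim/tensor_ind: t => [m n|s t IHs IHt].
  by rewrite !contractE -scalerDl.
by rewrite !contractD IHs IHt addrACA.
Qed.

Lemma contract_dualZ (N : lmodType R) (t : tensor M N) a xi :
  contract (a *: xi) t = a *: contract xi t.
Proof.
elim/tensor_ind: t => [m n|s t IHs IHt]; first by rewrite !contractE scalerA.
by rewrite !contractD IHs IHt scalerDr.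
Qed.

Lemma contract_nat (N P : lmodType R) (g : N -> P) xi : linear g ->
  forall t : tensor M N, g (contract xi t) = contract xi (tmap idfun g t).
Proof.
move=> gl; have idr := @rlinear_id _ M.
have gD : {morph g : x y / x + y} by move=> x y; have := gl 1 x y; rewrite !scale1r.
have gZ a x : g (a *: x) = a *: g x.
  by have := gl a x 0; rewrite !addr0 (morphD0 gD) addr0.
elim/tensor_ind => [m n|s t IHs IHt]; first by rewrite tmapE // !contractE gZ.
by rewrite tmapD // !contractD gD IHs IHt.
Qed.

Lemma contract_tassoc (T : pzRingType) (N : bimodType R T) (P : lmodType T) xi
    (t : tensor [the rmodType T of tensor M N] P) :
  contract xi (tassoc t) = tmap (@contract N xi) idfun t.
Proof.
have cl := contract_rlinear N xi; have idl := @linear_id _ P.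
move: t; apply: tensor3_ext => [x y|x y|m n p].
- by rewrite tassocD contractD.
- exact: tmapD.
- by rewrite tassocE contractE tensZ tmapE // contractE.
Qed.

(** The identity of M is the sum of the maps e i ⊗ xi i, and N tensors it. *)
Lemma tensor_dual_basis (N : lmodType R) n (e : 'I_n -> M) (xi : 'I_n -> dual M) :
  dual_basis e xi -> forall t : tensor M N, t = \sum_i e i ⊗ contract (xi i) t.
Proof.
move=> exi; elim/tensor_ind => [m x|s t IHs IHt].
  rewrite {1}(exi m) tens_suml; apply: eq_bigr => i _.
  by rewrite contractE tensA.
rewrite {1}IHs {1}IHt -big_split; apply: eq_bigr => i _.
by rewrite contractD tensDr.
Qed.

End Contract.

Section CanonicalMap.
Variables (k : comPzRingType) (A : algType k) (C : coring A) (M : comodule C).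
Local Notation rC := (regular_comodule C).

Lemma dual_colin_coact (xi : dual M) (m : M) :
  comul (contract xi (coact m)) =
  tmap (fun m0 : M => contract xi (coact m0)) (@idfun C) (coact m).
Proof.
rewrite (contract_nat xi (@comul_linear k A C)) -coactA contract_tassoc.
by rewrite (tmap_comp (contract_rlinear C xi) _ (coact_rlinear M)).
Qed.

(** One direction of the bijection between dual M and colinear maps M -> C, the
    other being composition with the counit. It identifies the canonical map with
    the evaluation map at C, whence their surjectivity is equivalent. *)
Definition dual_colin (xi : dual M) : colin M rC :=
  @Colin _ _ _ M rC (fun m => contract xi (coact m))
    (rlinear_comp (contract_rlinear C xi) (coact_rlinear M)) (dual_colin_coact xi).

Lemma counit_dual_colin (xi : dual M) m : counit (dual_colin xi m : C) = xi m.
Proof.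
rewrite /= -[in RHS](coact_counit m).
have bM := @counit_balanced k A C M.
elim/tensor_ind: (coact m) => [m0 c|s t IHs IHt].
  by rewrite contractE (tliftE bM) counitZ dual_ract.
by rewrite contractD counitD IHs IHt (tliftD bM) dualD.
Qed.

Definition counit_dual (f : colin M rC) : dual M.
Proof.
exists (fun m => counit (f m : C)) => [x y|m a]; first by rewrite colinD counitD.
by rewrite colin_ract counit_ract.
Defined.

Lemma counit_dualK (f : colin M rC) : dual_colin (counit_dual f) = f.
Proof.
apply: colin_eq => m; rewrite -[RHS](comul_counitl (f m : C)).
have -> : comul (f m : C) = _ := colin_coact f m.
have fl := colin_rlinear f; have lC := @linear_id _ C.
have bC : balanced (fun y z : C => counit y *: z).
  split=> [z y y'|y z z'|y a z]; first by rewrite counitD scalerDl.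
    by rewrite scalerDr.
  by rewrite counit_ract scalerA.
rewrite /=; elim/tensor_ind: (coact m) => [m0 c|s t IHs IHt].
  by rewrite contractE tmapE // (tliftE bC).
by rewrite contractD IHs IHt (tmapD fl lC) (tliftD bC).
Qed.

Lemma can_map_balanced :
  balanced (fun (xi : dual M) (m : endmod M) => dual_colin xi m : C).
Proof.
split=> [m xi zeta|xi m m'|xi s m].
- exact: contract_dualD.
- exact: (colinD (dual_colin xi)).
have -> : s *: m = s m by [].
rewrite /= colin_coact; have [sl lC] := (colin_rlinear s, @linear_id _ C).
elim/tensor_ind: (coact _) => [m0 c|u v IHu IHv].
  by rewrite tmapE // !contractE.
by rewrite (tmapD sl lC) !contractD IHu IHv.
Qed.

Lemma can_mapE (xi : dual M) (m : endmod M) : can_map (xi ⊗ m) = dual_colin xi m :> C.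
Proof. exact: (tliftE can_map_balanced). Qed.

Lemma can_mapD : {morph @can_map _ _ _ M : x y / x + y}.
Proof. exact: (tliftD can_map_balanced). Qed.

(** For the coproducts, both sides at zeta ⊗ m are obtained from the coaction of m
    by applying dual_colin zeta to its first leg: the right-hand side is the
    expansion of that coaction in the dual basis. *)
Lemma can_map_coring_morphism n (e : 'I_n -> M) (xi : 'I_n -> dual M)
    (exi : dual_basis e xi) :
  coring_morphism (C := comatrix_coring exi) (D := C) (can_map (M := M)).
Proof.
pose f : comatrix_coring exi -> C := can_map (M := M).
have fD : {morph f : x y / x + y} := can_mapD.
have fE (zeta : dual M) (m : endmod M) : f (zeta ⊗ m) = dual_colin zeta m := can_mapE zeta m.
have fl : linear f.
  move=> a x y; rewrite fD; congr (_ + _).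
  elim/tensor_ind: x => [zeta m|s t IHs IHt].
    by rewrite [a *: _]tensZ !fE /= contract_dualZ.
  by rewrite [a *: _]scalerDr [LHS]fD [f (s + t)]fD IHs IHt scalerDr.
have fr : rlinear f.
  split=> // x a; elim/tensor_ind: x => [zeta m|s t IHs IHt].
    by rewrite [_ :* a]tens_ract !fE colin_ract.
  by rewrite [_ :* a]ractDl [LHS]fD [f (s + t)]fD IHs IHt ractDl.
split=> //; rewrite -/f; apply: tensor_ind => [zeta m|s t IHs IHt].
- rewrite fE -[comul _]/(coact (dual_colin zeta m)) colin_coact.
  have -> : @comul _ _ (comatrix_coring exi) (zeta ⊗ m) = _ := comatrix_comulE exi zeta m.
  rewrite (morph_sum (tmapD fr fl)).
  have zl := colin_rlinear (dual_colin zeta); have lC := @linear_id _ C.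
  rewrite {1}(tensor_dual_basis exi (coact (m : M))) (morph_sum (tmapD zl lC)).
  apply: eq_bigr => i _.
  by rewrite (tmapE zl lC) (tmapE fr fl) !fE.
- rewrite [f _]fD comulD IHs IHt -(tmapD fr fl).
  by congr (tmap f f _); rewrite -(@comulD _ _ (comatrix_coring exi)).
- rewrite fE [RHS](comatrix_counitE zeta m); exact: counit_dual_colin.
- by rewrite [f _]fD counitD IHs IHt -(@counitD _ _ (comatrix_coring exi)).
Qed.

Lemma can_map_surj :
  surjection (evaluation M rC) <-> surjection (@can_map _ _ _ M).
Proof.
split=> sur c; have [t <-] := sur c; elim/tensor_ind: t => [f m|s t [s' sE] [t' tE]].
- by exists (counit_dual f ⊗ m); rewrite can_mapE counit_dualK /= evE.
- by exists (s' + t'); rewrite can_mapD sE tE [in RHS]colinD.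
- by exists (dual_colin f ⊗ m); rewrite can_mapE /= evE.
- by exists (s' + t'); rewrite colinD sE tE [in RHS]can_mapD.
Qed.

End CanonicalMap.

(** * Galois comodules over division rings *)

(** A linear form with value 1 at x, by Zorn's lemma: a submodule W maximal among
    those avoiding x is a complement of the line through x, and f is the projection
    onto that line along W. *)
Lemma division_ring_functional (S : pzRingType) (V : lmodType S) (x : V) :
  division_ring S -> x != 0 ->
  exists f : V -> S, [/\ {morph f : u v / u + v}, forall s v, f (s *: v) = s * f v & f x = 1].
Proof.
move=> [S1 Sdiv] x0.
(* Zero is not required to lie in W, so that the empty chain is no exception. *)
pose P (W : set V) := [/\ forall u v, W u -> W v -> W (u + v),
  forall s v, W v -> W (s *: v) & ~ W x].
have [F FP F_tot|W [[WD WZ Wx] W_max]] := @Zorn_bigcup V P.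
  split=> [u v [X FX Xu] [Y FY Yv]|s v [X FX Xv]|[X FX Xx]].
  - have [XY|YX] := F_tot X Y FX FY.
      by have [YD _ _] := FP Y FY; exists Y => //; apply: YD => //; exact: XY.
    by have [XD _ _] := FP X FX; exists X => //; apply: XD => //; exact: YX.
  - by have [_ XZ _] := FP X FX; exists X => //; apply: XZ.
  - by have [_ _] := FP X FX; apply.
have W0 : W 0.
  apply: contrapT => nW0; pose B := [set v | W v \/ v = 0]%classic.
  apply: (W_max B); first by split=> [v Wv|/(_ 0) WB0]; [left|apply/nW0/WB0; right].
  split=> [u v [Wu|->] [Wv|->]|s v [Wv|->]|[//|/eqP]]; rewrite ?addr0 ?add0r ?scaler0.
  - by left; apply: WD.
  - by left.
  - by left.
  - by right.
  - by left; apply: WZ.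
  - by right.
  - by apply/negP.
have W_span v : ~ W v -> exists w s, W w /\ x = w + s *: v.
  move=> nWv; apply: contrapT => nx.
  pose B := [set u | exists w s, W w /\ u = w + s *: v]%classic.
  apply: (W_max B).
    split=> [w Ww|/(_ v) WBv]; first by exists w, 0; rewrite scale0r addr0.
    by apply/nWv/WBv; exists 0, 1; rewrite scale1r add0r.
  split=> // [_ _ [w [s [Ww ->]]] [w' [s' [Ww' ->]]]|t _ [w [s [Ww ->]]]].
    by exists (w + w'), (s + s'); rewrite scalerDl addrACA; split=> //; apply: WD.
  by exists (t *: w), (t * s); rewrite scalerDr scalerA; split=> //; apply: WZ.
have WB u v : W u -> W v -> W (u - v).
  by move=> Wu Wv; apply: WD => //; rewrite -scaleN1r; apply: WZ.
have W_line s : W (s *: x) -> s = 0.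
  move=> Wsx; apply/eqP/negPn/negP => /Sdiv[t [_ ts]]; apply: Wx.
  by rewrite -(scale1r x) -ts -scalerA; apply: WZ.
have /choice[f fE] : forall v, exists s, W (v - s *: x).
  move=> v; have [Wv|/W_span[w [s [Ww xE]]]] := pselect (W v).
    by exists 0; rewrite scale0r subr0.
  have /Sdiv[t [_ ts]] : s != 0.
    by apply/eqP => s0; apply: Wx; rewrite xE s0 scale0r addr0.
  exists t; rewrite xE scalerDr scalerA ts scale1r opprD addrCA subrr addr0.
  by rewrite -scalerN -scaleN1r; exact/WZ/WZ.
have f_uniq v s : W (v - s *: x) -> f v = s.
  move=> Wvs; apply/eqP; rewrite -subr_eq0; apply/eqP/W_line.
  by have := WB _ _ Wvs (fE v); rewrite opprB addrC addrA subrK scalerBl.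
exists f; split=> [u v|s v|].
- by apply: f_uniq; rewrite scalerDl opprD addrACA; apply: WD.
- by apply: f_uniq; rewrite -scalerA -scalerBr; apply: WZ.
- by apply: f_uniq; rewrite scale1r subrr.
Qed.

Section GaloisSimple.
Variables (k : comPzRingType) (A : algType k) (C : coring A) (M : comodule C).
Local Notation rC := (regular_comodule C).

Lemma scale_colin_coact (a : A) (g : colin M rC) m :
  comul (a *: (g m : C)) = tmap (fun m0 : M => a *: (g m0 : C)) (@idfun C) (coact m).
Proof.
rewrite comulZ; have -> : comul (g m : C) = _ := colin_coact g m.
rewrite [LHS]/(tscale _ _) /tscale.
by rewrite (tmap_comp (rlinear_scale C a) _ (colin_rlinear g)).
Qed.

Definition scale_colin (a : A) (g : colin M rC) : colin M rC :=
  @Colin _ _ _ M rC (fun m => a *: (g m : C))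
    (rlinear_comp (rlinear_scale C a) (colin_rlinear g)) (scale_colin_coact a g).

(** Let lam be a linear form on M over End(M) with lam (f n0) = 1. As C is
    isomorphic to Hom(M, C) ⊗ M, lam yields Theta : C -> Hom(M, C) with Theta (g m) = g o lam m. Given y in M, put
    theta c = counit (Theta c y), a left A-linear form on C. Then N ⊗ theta applied
    to the coaction of n0 is a preimage of y: its image under f is M ⊗ theta
    applied to the coaction of x = f n0, and expanding this coaction as the
    sum of e_i ⊗ dual_colin xi_i x gives the sum of e_i xi_i (lam x y), that is
    lam x y = y. *)
Lemma galois_division_surj (N : comodule C) (f : colin N M) (n0 : N) :
  galois M -> division_ring (colin M M) -> f n0 != 0 -> surjection f.
Proof.
move=> [M_fg M_proj [psi [evK psiK]]] Sdiv fn0 y.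
have [n [e [xi exi]]] := dual_basis_exists M_fg M_proj.
have [lam [lamD lamZ lam1]] :=
  division_ring_functional (V := endmod M) (x := f n0) Sdiv fn0.
have bal : balanced (fun (g : colin M rC) (m : endmod M) => g :* lam m).
  split=> [m g h|g m m'|g s m]; first by rewrite ractDl.
    by rewrite lamD ractDr.
  by rewrite lamZ ractA.
pose Theta (c : C) : colin M rC := tlift (fun g m => g :* lam m) (psi c).
have ThetaD : {morph Theta : c d / c + d}.
  by move=> c d; rewrite /Theta (colinD psi) (tliftD bal).
have ThetaE (g : colin M rC) m : Theta (g m) = g :* lam m.
  have -> : g m = evaluation M rC (g ⊗ (m : endmod M)) by rewrite /= evE.
  rewrite /Theta -[psi _]/(colin_comp psi (evaluation M rC) _) psiK.
  exact: (tliftE bal).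
have ThetaZ a c : Theta (a *: c) = scale_colin a (Theta c).
  have -> : c = evaluation M rC (psi c).
    by rewrite -[RHS]/(colin_comp (evaluation M rC) psi c) evK.
  elim/tensor_ind: (psi c) => [g m|s t IHs IHt].
    rewrite [evaluation _ _ _]evE -[a *: _]/(scale_colin a g m) !ThetaE.
    exact: colin_eq.
  rewrite (colinD (evaluation M rC)) [a *: _]scalerDr ThetaD IHs IHt ThetaD.
  by apply: colin_eq => m /=; rewrite scalerDr.
pose theta (c : C) : A := counit (Theta c y : C).
have balt (X : comodule C) : balanced (fun (x : X) (c : C) => x :* theta c).
  split=> [c x x'|x c d|x a c]; first by rewrite ractDl.
    by rewrite /theta ThetaD (@colin_addE _ _ C M rC) counitD ractDr.
  by rewrite /theta ThetaZ /= counitZ ractA.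
exists (tlift (fun x c => x :* theta c) (coact n0)).
transitivity (lam (f n0) y); last by rewrite lam1.
transitivity (tlift (fun x c => x :* theta c) (coact (f n0))).
  rewrite colin_coact; have [fl lC] := (colin_rlinear f, @linear_id _ C).
  elim/tensor_ind: (coact n0) => [x c|s t IHs IHt].
    by rewrite tmapE // !(tliftE (balt _)) colin_ract.
  by rewrite (tmapD fl lC) !(tliftD (balt _)) colinD IHs IHt.
rewrite {1}(tensor_dual_basis exi (coact (f n0))) (morph_sum (tliftD (balt M))).
rewrite [RHS](exi (lam (f n0) y)); apply: eq_bigr => i _.
rewrite (tliftE (balt M)) /theta -[contract _ _]/(dual_colin (xi i) (f n0)) ThetaE.
by rewrite -counit_dual_colin.
Qed.

Lemma galois_division_simple (C_flat : left_flat C) :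
  galois M -> division_ring (colin M M) -> simple_comodule M.
Proof.
move=> M_galois Sdiv; split=> [|N f /(monomorphism_inj C_flat) f_inj].
  apply: contrapT => M0; case: Sdiv => /eqP[]; apply: colin_eq => m /=.
  by apply: contrapT => /eqP m0; apply: M0; exists m.
have [f0|/existsNP[n0 /eqP fn0]] := pselect (forall n, f n = 0); [left|right].
  exact: colin_eq.
by apply: bijective_isomorphism => //; apply: galois_division_surj fn0.
Qed.

End GaloisSimple.

Theorem corollary3p2 (k : comPzRingType) (A : algType k) (C : coring A)
    (C_flat : left_flat C) :
  (forall M : comodule C,
     galois M -> division_ring (colin M M) -> simple_comodule M)
  /\
  (forall M : comodule C,
     simple_comodule M -> finitely_generated M -> projective M ->
   forall (n : nat) (e : 'I_n -> M) (xi : 'I_n -> dual M) (exi : dual_basis e xi),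
     [<-> (* (a) *) galois M;
          (* (b) *) forall N : comodule C, surjection (evaluation M N);
          (* (c) *) surjection (evaluation M (regular_comodule C));
          (* (d) *) surjection (can_map (M := M)) /\
                    coring_morphism (C := comatrix_coring exi) (D := C) (can_map (M := M))]).
Proof.
split=> [M|M M_simple M_fg M_proj n e xi exi]; first exact: galois_division_simple.
tfae=> [[_ _ ev_iso]|ev_surj|ev_surj|[can_surj _]].
- exact: (simple_evaluation_surj C_flat M_simple (isomorphism_surj ev_iso)).
- exact: ev_surj.
- by split; [exact/can_map_surj|exact: can_map_coring_morphism].
- split=> //; apply: bijective_isomorphism; last exact/can_map_surj.
  exact: simple_evaluation_inj.
Qed.
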